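(* Let $\mathcal T=\{T_1,\dots,T_m\}\subset\mathbb C^{d\times d}$ be a family of matrices that are all upper triangular or all lower triangular, with nonzero diagonal entries $(T_i)_{jj}=\lambda_j^{(i)}$, and with probability weights $p_1,\dots,p_m$. Let $\mu_j:=\sum_i p_i\log|\lambda_j^{(i)}|$, $\rho_\infty:=\max_j e^{\mu_j}$, and suppose the set of maximizing indices $J:=\arg\max_j\mu_j=\{j_1,\dots,j_s\}$ has $s>1$ elements. Let $\Sigma_J=(\Sigma(\ell,h))_{\ell,h\in J}$ with $\Sigma(\ell,h)=\sum_i p_i\log|\lambda_\ell^{(i)}|\log|\lambda_h^{(i)}|-\mu_\ell\mu_h$, and assume $\Sigma_J$ is positive definite. Let $\boldsymbol Z_{k,J}=(\log|\lambda_j^{(i_k)}|)_{j\in J}$, $\boldsymbol\mu_J=(\mu_j)_{j\in J}$, $$S_n:=\frac1{\sqrt n}\sum_{k=1}^n(\boldsymbol Z_{k,J}-\boldsymbol\mu_J),$$ let $\boldsymbol U\sim\mathcal N(\boldsymbol 0,\Sigma_J)$ and $M(\boldsymbol u):=\max_{j\in J}u_j$ for $\boldsymbol u\in\mathbb R^J$. Set $m_k:=\mathbb E[M(\boldsymbol U)^k]$ for $k=1,2,3$, $v_0:=m_2-m_1^2$, $v_1:=m_3-m_1m_2$. Then, as $n\to\infty$, $$\mathbb E[\rho_n]=\rho_\infty\left(1+\frac{m_1}{\sqrt n}+o(n^{-1/2})\right),\qquad n\operatorname{Var}(\rho_n)=\rho_\infty^2\bigl(v_0+o(1)\bigr).$$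 Suppose in addition that, for the two test functions $f=M$ and $f=M^2$, $$\mathbb E[f(S_n)]=\mathbb E[f(\boldsymbol U)]+\frac1{\sqrt n}\sum_{|\alpha|=3}\frac{\kappa_\alpha}{\alpha!}\,\mathbb E\bigl[f(\boldsymbol U)H_\alpha^{\Sigma_J}(\boldsymbol U)\bigr]+o(n^{-1/2}),$$ and define $h_\alpha:=\mathbb E[M(\boldsymbol U)H_\alpha^{\Sigma_J}(\boldsymbol U)]$, $r_\alpha:=\mathbb E[M(\boldsymbol U)^2H_\alpha^{\Sigma_J}(\boldsymbol U)]$. Then $$\mathbb E[\rho_n]=\rho_\infty\left[1+\frac{m_1}{\sqrt n}+\frac1n\left(\frac{m_2}{2}+\sum_{|\alpha|=3}\frac{\kappa_\alpha}{\alpha!}h_\alpha\right)+o(n^{-1})\right],$$ $$n\operatorname{Var}(\rho_n)=\rho_\infty^2\left[v_0+\frac1{\sqrt n}\left(v_1+\sum_{|\alpha|=3}\frac{\kappa_\alpha}{\alpha!}\bigl(r_\alpha-2m_1h_\alpha\bigr)\right)+o(n^{-1/2})\right].$$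
   Context: $\mathbb P_{\mathcal T}$ assigns mass $p_i\ge 0$ to $T_i$, with $\sum_i p_i=1$. $(i_k)_{k\ge1}$ are i.i.d. random indices in $\{1,\dots,m\}$ with $\mathbb P(i_k=i)=p_i$, and $\rho_n:=\rho(T_{i_n}\cdots T_{i_1})^{1/n}$ is the random spectral radius of length $n$, where $\rho(\cdot)$ is the spectral radius. Multi-index notation: identifying $\mathbb R^J$ with $\mathbb R^s$, for $\alpha\in\mathbb Z_{\ge0}^s$ let $|\alpha|=\sum_k\alpha_k$, $\alpha!=\alpha_1!\cdots\alpha_s!$, $\partial^\alpha=\partial_{u_1}^{\alpha_1}\cdots\partial_{u_s}^{\alpha_s}$; sums over $|\alpha|=3$ range over all such multi-indices. The generalized cumulants are $\kappa_\alpha:=\partial_{\boldsymbol\beta}^\alpha\log\mathbb E\exp\bigl(\boldsymbol\beta^\top(\boldsymbol Z_{1,J}-\boldsymbol\mu_J)\bigr)\big|_{\boldsymbol\beta=0}$. With $\varphi_{\Sigma_J}$ the density of $\mathcal N(\boldsymbol 0,\Sigma_J)$, the $\Sigma_J$-Hermite polynomials are $H_\alpha^{\Sigma_J}(\boldsymbol u):=(-1)^{|\alpha|}\varphi_{\Sigma_J}(\boldsymbol u)^{-1}\,\partial^\alpha\varphi_{\Sigma_J}(\boldsymbol u)$. *)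

(* Defs.v *)
From HB Require Import structures.
From mathcomp Require Import all_boot all_order all_algebra.
From mathcomp Require Import complex.
From mathcomp Require Import all_classical all_reals all_analysis.
Set Implicit Arguments.
Unset Strict Implicit.
Unset Printing Implicit Defensive.
Import Order.TTheory GRing.Theory Num.Theory.
Import numFieldNormedType.Exports.
Import ComplexField.Normc.
Local Open Scope classical_set_scope.
Local Open Scope ring_scope.

(* The maximum of a finite nonempty family, written as a supremum so that no
   default value is needed. *)
Definition fmax (R : realType) (I : finType) (x : I -> R) : R := sup (range x).

Definition vmax (R : realType) (s : nat) (u : 'rV[R]_s) : R := fmax (u 0).

Definition spectral_radius (R : realType) (d : nat) (A : 'M[R[i]]_d) : R :=
  sup [set normc a | a in [set a : R[i] | eigenvalue A a]].

(* With 0-based time, [idx k] is the random index $i_{k+1}$, so that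
   [word_prod T w n] is $T_{w_{n-1}} \cdots T_{w_0}$. *)
Fixpoint word_prod (R : realType) (d m : nat) (T : 'I_m -> 'M[R[i]]_d)
    (w : nat -> 'I_m) (n : nat) : 'M[R[i]]_d :=
  if n is n'.+1 then T (w n') *m word_prod T w n' else 1%:M.

Definition rho (R : realType) (d m : nat) (T : 'I_m -> 'M[R[i]]_d) (Omega : Type)
    (idx : nat -> Omega -> 'I_m) (n : nat) (w : Omega) : R :=
  spectral_radius (word_prod T (idx ^~ w) n) `^ (n%:R^-1).

Section Weights.
Context (R : realType) (d m : nat) (T : 'I_m -> 'M[R[i]]_d) (p : 'I_m -> R).

Definition loglam (i : 'I_m) (j : 'I_d) : R := ln (normc (T i j j)).

Definition mu (j : 'I_d) : R := \sum_i p i * loglam i j.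

Definition rho_infty : R := fmax (fun j : 'I_d => expR (mu j)).

Definition argmax_mu : {set 'I_d} :=
  [set j | [forall h : 'I_d, mu h <= mu j]].

Definition covlog (l h : 'I_d) : R :=
  \sum_i p i * loglam i l * loglam i h - mu l * mu h.

(* $\mathbb R^J$ is identified with the row vectors of length $s = |J|$
   through the enumeration [enum_val] of $J$. *)
Definition mu_on (J : {set 'I_d}) : 'rV[R]_#|J| := \row_k mu (enum_val k).

Definition Sigma_on (J : {set 'I_d}) : 'M[R]_#|J| :=
  \matrix_(k, l) covlog (enum_val k) (enum_val l).

Definition Z_on (Omega : Type) (idx : nat -> Omega -> 'I_m) (J : {set 'I_d})
    (k : nat) (w : Omega) : 'rV[R]_#|J| :=
  \row_l loglam (idx k w) (enum_val l).

Definition S_on (Omega : Type) (idx : nat -> Omega -> 'I_m) (J : {set 'I_d})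
    (n : nat) (w : Omega) : 'rV[R]_#|J| :=
  (Num.sqrt n%:R)^-1 *: \sum_(k < n) (Z_on idx J k w - mu_on J).

End Weights.

Definition dotv (R : realType) (s : nat) (a b : 'rV[R]_s) : R :=
  \sum_k a 0 k * b 0 k.

Definition quadv (R : realType) (s : nat) (A : 'M[R]_s) (a : 'rV[R]_s) : R :=
  dotv (a *m A) a.

Definition posdefmx (R : realType) (s : nat) (A : 'M[R]_s) : Prop :=
  A^T = A /\ forall a : 'rV[R]_s, a != 0 -> 0 < quadv A a.

Definition mutually_independent (dsp : measure_display)
    (Omega : measurableType dsp) (R : realType) (P : probability Omega R)
    (I : Type) (X : nat -> Omega -> I) : Prop :=
  forall (F : seq nat) (A : nat -> set I), uniq F ->
    P (\bigcap_(k in [set` F]) (X k @^-1` A k)) =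
    (\prod_(k <- F) P (X k @^-1` A k))%E.

Definition iid_indices (dsp : measure_display) (Omega : measurableType dsp)
    (R : realType) (P : probability Omega R) (m : nat) (p : 'I_m -> R)
    (idx : nat -> Omega -> 'I_m) : Prop :=
  [/\ forall k i, measurable (idx k @^-1` [set i]),
      forall k i, P (idx k @^-1` [set i]) = (p i)%:E
    & mutually_independent P idx].

(* [U] has law N(0, Sigma), for Sigma positive definite: every nontrivial linear
   combination [dotv a U] has law N(0, a Sigma a^T). The second parameter of
   [normal_prob] is the standard deviation; [a = 0] is excluded because
   [normal_prob 0 0] is not the Dirac mass at 0. *)
Definition centered_gaussian (dsp : measure_display)
    (Omega : measurableType dsp) (R : realType) (P : probability Omega R)
    (s : nat) (Sigma : 'M[R]_s) (U : Omega -> 'rV[R]_s) : Prop :=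
  (forall k, measurable_fun setT (fun w => U w 0 k)) /\
  forall a : 'rV[R]_s, a != 0 -> forall B : set R, measurable B ->
    P ((fun w => dotv a (U w)) @^-1` B) =
    normal_prob 0 (Num.sqrt (quadv Sigma a)) B.

(* $\partial^\alpha = \partial_{u_1}^{\alpha_1} \cdots \partial_{u_s}^{\alpha_s}$ *)
Definition mpartial (R : realType) (s : nat) (alpha : 'I_s -> nat)
    (f : 'rV[R]_s -> R) : 'rV[R]_s -> R :=
  foldr (fun k g => iter (alpha k) (fun h => 'D_(delta_mx 0 k) h) g) f
    (enum 'I_s).

Definition gauss_density (R : realType) (s : nat) (Sigma : 'M[R]_s)
    (u : 'rV[R]_s) : R :=
  (Num.sqrt ((2 * pi) ^+ s * \det Sigma))^-1 *
  expR (- quadv (invmx Sigma) u / 2).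

Definition hermite (R : realType) (s : nat) (Sigma : 'M[R]_s)
    (alpha : 'I_s -> nat) (u : 'rV[R]_s) : R :=
  (-1) ^+ (\sum_k alpha k)%N * (gauss_density Sigma u)^-1 *
  mpartial alpha (gauss_density Sigma) u.

(* [fine] would send an infinite expectation to 0; [mean] is only applied to
   integrable functions. *)
Definition mean (dsp : measure_display) (Omega : measurableType dsp)
    (R : realType) (P : probability Omega R) (X : Omega -> R) : R :=
  fine ('E_P[X])%E.

Definition cumulant (R : realType) (d m : nat) (T : 'I_m -> 'M[R[i]]_d)
    (p : 'I_m -> R) (dsp : measure_display) (Omega : measurableType dsp)
    (P : probability Omega R) (idx : nat -> Omega -> 'I_m) (J : {set 'I_d})
    (alpha : 'I_#|J| -> nat) : R :=
  mpartial alpha (fun beta : 'rV[R]_#|J| =>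
    ln (mean P (fun w => expR (dotv beta (Z_on T idx J 0 w - mu_on T p J))))) 0.

Definition mfact (s : nat) (alpha : 'I_s -> nat) : nat :=
  (\prod_k (alpha k)`!)%N.

(* Sum over all multi-indices with $|\alpha| = 3$; these have entries at most 3,
   so they are exactly the 'I_4-valued ones of weight 3. *)
Definition sum3 (R : realType) (s : nat) (F : ('I_s -> nat) -> R) : R :=
  \sum_(alpha : {ffun 'I_s -> 'I_4} | (\sum_k alpha k == 3)%N)
    F (fun k => alpha k).

Definition edgeworth (R : realType) (d m : nat) (T : 'I_m -> 'M[R[i]]_d)
    (p : 'I_m -> R) (dsp : measure_display) (Omega : measurableType dsp)
    (P : probability Omega R) (idx : nat -> Omega -> 'I_m) (J : {set 'I_d})
    (dsp' : measure_display) (Omega' : measurableType dsp')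
    (P' : probability Omega' R) (U : Omega' -> 'rV[R]_#|J|)
    (f : 'rV[R]_#|J| -> R) : Prop :=
  exists2 e : nat -> R, e =o_\oo (fun n => (Num.sqrt n%:R)^-1) &
  forall n, (0 < n)%N ->
    mean P (f \o S_on T p idx J n) =
    mean P' (f \o U) +
    (Num.sqrt n%:R)^-1 *
      sum3 (fun alpha => cumulant T p P idx alpha / (mfact alpha)%:R *
        mean P' (fun w => f (U w) * hermite (Sigma_on T p J) alpha (U w)))
    + e n.

(* Main.v *)
Require Import Defs.
From HB Require Import structures.
From mathcomp Require Import all_boot all_order all_algebra.
From mathcomp Require Import complex ring lra.
From mathcomp Require Import all_classical all_reals all_analysis.
From mathcomp Require Import measurable_realfun.
Import Order.TTheory GRing.Theory Num.Theory.
Import numFieldNormedType.Exports.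
Import ComplexField.Normc.
Local Open Scope classical_set_scope.
Local Open Scope ring_scope.

(** The matrices being triangular, rho_n = exp (max_j A_j / n) where A_j is the
    sum of the log|lambda_j| along the random word. Coordinates outside J
    overtake those in J only with exponentially small probability, so, with
    eps = n^(-1/2), rho_n / rho_infty can be replaced by exp (eps M(S_n)); all
    expectations over words are finite sums, and expanding the exponential to
    third order leaves an error O(eps^4) because the exponential moments of S_n
    are bounded uniformly in n. The mean and the variance of rho_n are thus
    explicit polynomials in eps and the moments E[M(S_n)^k], k <= 3, up to
    O(eps^4), and the theorem follows from E[M(S_n)^k] --> E[M(U)^k], refined by
    the Edgeworth hypotheses.

    This convergence is a central limit theorem for an unbounded non-smooth
    function. Since U is only known through its linear forms, it is tested
    against trigonometric polynomials, that is, combinations of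
    cos (t + a . u). The maximum of the w^-1 sin (w u_j) is a uniform limit of
    such functions (|x| is a uniform limit of polynomials on [-1, 1]) and is
    within O(w |u|^2) of M(u), so M^k is a limit of trigonometric polynomials for
    the sup norm weighted by exp |u|. *)

(** * Taylor bounds *)

Section TaylorBounds.
Context {R : realType}.
Implicit Types (f df : R -> R) (x t B C : R).

(** By the mean value theorem [f x = df c * x] with [c] between 0 and [x]. Each Taylor remainder
    below has the previous one as derivative, so this step is iterated; the constant is not divided
    by [k.+1], since only the order of the bounds matters. *)
Lemma norm_le_derive (f df : R -> R) (B C : R) (k : nat) :
  (forall x, is_derive x 1 f (df x)) -> f 0 = 0 -> 0 <= C ->
  (forall x, `|x| <= B -> `|df x| <= C * `|x| ^+ k) ->
  forall x, `|x| <= B -> `|f x| <= C * `|x| ^+ k.+1.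
Proof.
move=> fd f0 C0 dfle x xB.
have cf : continuous f.
  by move=> y; apply/differentiable_continuous/derivable1_diffP; case: (fd y).
(* Common end of the two signs of [x]: the mean value theorem is applied on [x, 0] or on [0, x]. *)
have key (a b c : R) : `|f b - f a| = `|f x| -> `|b - a| = `|x| ->
    f b - f a = df c * (b - a) -> `|c| <= `|x| ->
  `|f x| <= C * `|x| ^+ k.+1.
  move=> <- bax -> cx; rewrite normrM bax exprSr mulrA ler_wpM2r//.
  rewrite (le_trans (dfle _ (le_trans cx xB)))// ler_wpM2l// lerXn2r// nnegrE//.
have [x0|x0|->] := ltgtP x 0; last by rewrite f0 normr0 expr0n/= mulr0.
- have [] := @MVT R f df x 0 x0 _ _ => //.
    by apply: continuous_subspaceT => ?; exact: cf.
  move=> c; rewrite in_itv/= => /andP[xc c0] e.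
  apply: (key x 0 c) => //; rewrite ?f0 ?sub0r ?normrN//.
  by rewrite !ltr0_norm// lerN2 ltW.
- have [] := @MVT R f df 0 x x0 _ _ => //.
    by apply: continuous_subspaceT => ?; exact: cf.
  move=> c; rewrite in_itv/= => /andP[xc c0] e.
  apply: (key 0 x c) => //; rewrite ?f0 ?subr0//.
  by rewrite !gtr0_norm// ltW.
Qed.

Lemma norm_sin_le x : `|sin x| <= `|x|.
Proof.
rewrite -[leRHS]mul1r -[X in _ * X]expr1.
apply: (@norm_le_derive sin cos `|x| 1 0 _ (sin0 _) ler01) => //.
by move=> y _; rewrite expr0 mulr1 cos_max.
Qed.

Lemma norm_cosB1_le x : `|cos x - 1| <= `|x| ^+ 2.
Proof.
rewrite -[leRHS]mul1r.
apply: (@norm_le_derive (fun x => cos x - 1) (fun x => - sin x) `|x|) => //.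
- by move=> y; apply: is_derive_eq; rewrite subr0.
- by rewrite cos0 subrr.
- by move=> y _; rewrite normrN mul1r expr1 norm_sin_le.
Qed.

Lemma norm_sinB_le x : `|sin x - x| <= `|x| ^+ 3.
Proof.
rewrite -[leRHS]mul1r.
apply: (@norm_le_derive (fun x => sin x - x) (fun x => cos x - 1) `|x|) => //.
- by rewrite sin0 subrr.
- by move=> y _; rewrite mul1r norm_cosB1_le.
Qed.

(** The derivative is at most [2 * |y|] everywhere: by the quadratic bound when [|y| <= 1], and
    because cosines are bounded by 1 otherwise. *)
Lemma norm_sinB_le2 x : `|sin x - x| <= 2 * `|x| ^+ 2.
Proof.
apply: (@norm_le_derive (fun x => sin x - x) (fun x => cos x - 1) `|x|) => //.
- by rewrite sin0 subrr.
- move=> y _; have [y1|y1] := leP `|y| 1.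
    rewrite (le_trans (norm_cosB1_le _))// expr1 expr2 ler_wpM2r//.
    by rewrite (le_trans y1)// ler1n.
  rewrite expr1 (le_trans (ler_normB _ _))// normr1.
  by have := cos_max y; lra.
Qed.

Lemma norm_cosBB_le x : `|cos x - 1 + x ^+ 2 / 2| <= `|x| ^+ 4.
Proof.
rewrite -[leRHS]mul1r.
apply: (@norm_le_derive (fun x => cos x - 1 + x ^+ 2 / 2) (fun x => x - sin x) `|x|) => //.
- move=> y; apply: is_derive_eq; rewrite /GRing.scale/=.
  by field.
- by rewrite cos0 expr0n/= mul0r addr0 subrr.
- by move=> y _; rewrite distrC mul1r norm_sinB_le.
Qed.

Lemma expR_taylor1 B x : `|x| <= B -> `|expR x - 1| <= expR B * `|x|.
Proof.
move=> xB.
rewrite -[`|x| in leRHS]expr1.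
apply: (@norm_le_derive (fun x => expR x - 1) (@expR R) B) => //.
- by move=> y; apply: is_derive_eq; rewrite subr0.
- by rewrite expR0 subrr.
- by move=> y yB; rewrite expr0 mulr1 gtr0_norm ?expR_gt0// ler_expR (le_trans (ler_norm _)).
Qed.

Lemma expR_taylor2 B x : `|x| <= B -> `|expR x - 1 - x| <= expR B * `|x| ^+ 2.
Proof.
move=> xB.
apply: (@norm_le_derive (fun x => expR x - 1 - x) (fun x => expR x - 1) B) => //.
- by move=> y; apply: is_derive_eq; rewrite subr0.
- by rewrite expR0 subrr subr0.
- by move=> y yB; rewrite expr1 expR_taylor1.
Qed.

Lemma expR_taylor3 B x : `|x| <= B ->
  `|expR x - 1 - x - x ^+ 2 / 2| <= expR B * `|x| ^+ 3.
Proof.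
move=> xB.
apply: (@norm_le_derive (fun x => expR x - 1 - x - x ^+ 2 / 2)
  (fun x => expR x - 1 - x) B) => //.
- move=> y; apply: is_derive_eq; rewrite /GRing.scale/=.
  by field.
- by rewrite expR0 subrr expr0n/= mul0r !subr0.
- by move=> y yB; rewrite expR_taylor2.
Qed.

Lemma expR_taylor4 B x : `|x| <= B ->
  `|expR x - (1 + x + x ^+ 2 / 2 + x ^+ 3 / 6)| <= expR B * `|x| ^+ 4.
Proof.
move=> xB.
apply: (@norm_le_derive (fun x => expR x - (1 + x + x ^+ 2 / 2 + x ^+ 3 / 6))
  (fun x => expR x - 1 - x - x ^+ 2 / 2) B) => //.
- move=> y; apply: is_derive_eq; rewrite /GRing.scale/=.
  by field.
- by rewrite expR0 !expr0n/= !mul0r !addr0 subrr.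
- by move=> y yB; rewrite expR_taylor3.
Qed.

Lemma cos_taylor2 t x :
  `|cos (t + x) - (cos t * (1 - x ^+ 2 / 2) - sin t * x)| <= `|x| ^+ 3 + `|x| ^+ 4.
Proof.
rewrite cosD.
have -> : cos t * cos x - sin t * sin x - (cos t * (1 - x ^+ 2 / 2) - sin t * x) =
  cos t * (cos x - 1 + x ^+ 2 / 2) - sin t * (sin x - x) by ring.
rewrite (le_trans (ler_normB _ _))// !normrM addrC lerD//.
- by rewrite -[leRHS]mul1r ler_pM// ?sin_max ?norm_sinB_le.
- by rewrite -[leRHS]mul1r ler_pM// ?cos_max ?norm_cosBB_le.
Qed.

(** A single term of the exponential series is at most its sum. This is how polynomial growth is
    absorbed into exponential moments. *)
Lemma exprn_le_expR x k : 0 <= x -> x ^+ k <= k`!%:R * expR x.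
Proof.
move=> x0; case: k => [|k].
  rewrite expr0 mul1r (le_trans _ (expR_ge1Dx x))// lerDl//.
rewrite mulrC -ler_pdivrMr ?ltr0n ?fact_gt0//.
by rewrite (le_trans _ (expR_ge1Dxn k x0))// lerDr.
Qed.

(** The exponential lies between [1 - x] and [(1 + x)^-1 = 1 - x + x ^+ 2 / (1 + x)]. *)
Lemma expRN_taylor x : 0 <= x -> `|expR (- x) - (1 - x)| <= x ^+ 2.
Proof.
move=> x0.
have l := expR_ge1Dx (- x).
have x1 : 0 < 1 + x by rewrite ltr_wpDr.
have u : expR (- x) <= (1 + x)^-1.
  by rewrite expRN lef_pV2 ?posrE ?expR_gt0 ?expR_ge1Dx.
have e : (1 + x)^-1 = 1 - x + x ^+ 2 / (1 + x) by field; rewrite gt_eqF.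
have : x ^+ 2 / (1 + x) <= x ^+ 2.
  by rewrite ler_pdivrMr// ler_peMr ?sqr_ge0// lerDl.
by rewrite ger0_norm; lra.
Qed.

End TaylorBounds.

(** * Trigonometric approximation of the powers of the maximum *)

Section FiniteMax.
Context {R : realType} {I : finType}.
Implicit Types x y : I -> R.

(** The index [i0] witnesses that the family is nonempty, so that the supremum is a genuine maximum
    and not a default value. *)
Lemma fmax_attained x (i0 : I) :
  exists2 i, fmax x = x i & forall j, x j <= x i.
Proof.
case: (@arg_maxP _ _ _ i0 xpredT x isT) => i _ imax; exists i => [|j]; last exact: imax.
have ub : ubound (range x) (x i) by move=> _ [j _ <-]; exact: imax.
apply/eqP; rewrite eq_le; apply/andP; split.
  by apply: ge_sup => //; exists (x i), i.
by apply: ub_le_sup; [exists (x i)|exists i].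
Qed.

Lemma le_fmax x i : x i <= fmax x.
Proof. by have [j ->] := fmax_attained x i. Qed.

Lemma fmax_le x (i0 : I) c : (forall i, x i <= c) -> fmax x <= c.
Proof. by move=> xc; have [j ->] := fmax_attained x i0. Qed.

Lemma fmaxE x (i0 : I) : fmax x = \big[Num.max/x i0]_i x i.
Proof.
apply/eqP; rewrite eq_le; apply/andP; split.
  by apply: (fmax_le _ i0) => i; exact: le_bigmax.
by apply: bigmax_le => [|i _]; exact: le_fmax.
Qed.

(** Comparing both families at a maximizer of one of them bounds the difference of the maxima, once
    from each side. *)
Lemma fmax_dist x y (i0 : I) :
  `|fmax x - fmax y| <= \sum_i `|x i - y i|.
Proof.
have le1 (x' y' : I -> R) i : x' i - y' i <= \sum_i `|x' i - y' i|.
  rewrite (le_trans (ler_norm _))// (bigD1 i)//= lerDl sumr_ge0//.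
rewrite ler_norml; apply/andP; split.
  have [i -> _] := fmax_attained y i0.
  under eq_bigr do rewrite distrC.
  by have := le1 y x i; have := le_fmax x i; lra.
have [i -> _] := fmax_attained x i0.
by have := le1 x y i; have := le_fmax y i; lra.
Qed.

End FiniteMax.

Lemma fmax_homo (R : realType) (I : finType) (f : R -> R) (x : I -> R) (i0 : I) :
  {homo f : a b / a <= b} -> fmax (fun i => f (x i)) = f (fmax x).
Proof.
move=> fm; have [i xi imax] := fmax_attained x i0.
apply/eqP; rewrite eq_le xi; apply/andP; split.
  by apply: (fmax_le _ i0) => j; exact: fm.
exact: (le_fmax (fun i => f (x i)) i).
Qed.

(** * Linear forms and the l1 norm on row vectors *)

Section DotProduct.
Context {R : realType} {s : nat}.
Implicit Types a b u : 'rV[R]_s.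

Lemma dotvDl a b u : dotv (a + b) u = dotv a u + dotv b u.
Proof. by rewrite -big_split; apply: eq_bigr => k _; rewrite mxE mulrDl. Qed.

Lemma dotvZl c a u : dotv (c *: a) u = c * dotv a u.
Proof. by rewrite mulr_sumr; apply: eq_bigr => k _; rewrite mxE mulrA. Qed.

Lemma dotvC a b : dotv a b = dotv b a.
Proof. by apply: eq_bigr => k _; rewrite mulrC. Qed.

Lemma dotvNl a u : dotv (- a) u = - dotv a u.
Proof. by rewrite -scaleN1r dotvZl mulN1r. Qed.

Lemma dotv_delta k u : dotv (delta_mx 0 k) u = u 0 k.
Proof.
rewrite /dotv (bigD1 k)//= mxE !eqxx mul1r big1 ?addr0// => l lk.
by rewrite mxE (negPf lk) andbF mul0r.
Qed.

Definition normone (u : 'rV[R]_s) : R := \sum_k `|u 0 k|.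

Lemma normone_ge0 u : 0 <= normone u.
Proof. exact: sumr_ge0. Qed.

Lemma le_normone u k : `|u 0 k| <= normone u.
Proof. by rewrite /normone (bigD1 k)//= lerDl sumr_ge0. Qed.

Lemma norm_vmax_le u : (0 < s)%N -> `|vmax u| <= normone u.
Proof.
move=> s0; rewrite /vmax.
by have [k -> _] := fmax_attained (u 0) (Ordinal s0); exact: le_normone.
Qed.

Lemma normone_exp_le u k : normone u ^+ k <= k`!%:R * expR (normone u).
Proof. exact/exprn_le_expR/normone_ge0. Qed.

(* The l1 norm is at most [s] times the largest [`|u 0 k|]. *)
Lemma expR_normone_le u : (0 < s)%N ->
  expR (normone u) <= \sum_k (expR (dotv (s%:R *: delta_mx 0 k) u) +
                              expR (dotv (- s%:R *: delta_mx 0 k) u)).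
Proof.
move=> s0; have [k _ kmax] := fmax_attained (fun k => `|u 0 k|) (Ordinal s0).
have le1 : normone u <= s%:R * `|u 0 k|.
  rewrite /normone (le_trans (ler_sum _ (fun i _ => kmax i)))//.
  by rewrite sumr_const card_ord -[leLHS]mulr_natl.
rewrite (bigD1 k)//= -[leLHS]addr0 lerD//; last first.
  by apply: sumr_ge0 => i _; rewrite addr_ge0 ?expR_ge0.
rewrite !dotvZl dotv_delta.
have [u0|u0] := leP 0 (u 0 k).
  rewrite -[leLHS]addr0 lerD ?expR_ge0// ler_expR (le_trans le1)//.
  by rewrite ger0_norm.
rewrite -[leLHS]add0r lerD ?expR_ge0// ler_expR (le_trans le1)//.
by rewrite ltr0_norm// mulrN mulNr.
Qed.

End DotProduct.

(** * Trigonometric polynomials and their uniform closure *)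

Section TrigApproximation.
Context {R : realType} {s : nat}.
Implicit Types f g h : 'rV[R]_s -> R.

(** The phase [t] lets one constructor cover constants, sines and cosines, and keeps the class
    stable under products. *)
Inductive trigpoly : ('rV[R]_s -> R) -> Prop :=
| trigpoly_cos c t a : trigpoly (fun u => c * cos (t + dotv a u))
| trigpolyD f g : trigpoly f -> trigpoly g -> trigpoly (fun u => f u + g u).

(** By bilinearity it is enough to multiply two cosines, and their product is half the sum of the
    cosines of the sum and of the difference of the arguments. *)
Lemma trigpolyM f g : trigpoly f -> trigpoly g -> trigpoly (fun u => f u * g u).
Proof.
move=> Hf Hg; elim: Hf => [c t a|f1 f2 _ H1 _ H2]; last first.
  rewrite (_ : (fun u => _) = fun u => f1 u * g u + f2 u * g u).
    exact: trigpolyD.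
  by apply/funext => u; rewrite mulrDl.
elim: Hg => [c' t' a'|g1 g2 _ H1 _ H2]; last first.
  rewrite (_ : (fun u => _) = fun u => c * cos (t + dotv a u) * g1 u +
                                       c * cos (t + dotv a u) * g2 u).
    exact: trigpolyD.
  by apply/funext => u; rewrite mulrDr.
rewrite (_ : (fun u => _) = fun u =>
  (c * c' / 2) * cos ((t + t') + dotv (a + a') u) +
  (c * c' / 2) * cos ((t - t') + dotv (a - a') u)).
  by apply: trigpolyD; exact: trigpoly_cos.
apply/funext => u; rewrite !dotvDl dotvNl.
rewrite (_ : t + t' + _ = (t + dotv a u) + (t' + dotv a' u)); last by ring.
rewrite (_ : t - t' + _ = (t + dotv a u) - (t' + dotv a' u)); last by ring.
by move: (t + _) (t' + _) => x y; rewrite cosB cosD; field.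
Qed.

Lemma trigpoly_bounded f : trigpoly f -> exists2 B, 0 < B & forall u, `|f u| <= B.
Proof.
elim=> [c t a|f1 f2 _ [B1 B10 H1] _ [B2 B20 H2]].
  exists (`|c| + 1) => [|u]; first by rewrite ltr_wpDl.
  rewrite normrM (@le_trans _ _ `|c|)// ?lerDl//.
  by rewrite ler_piMr// cos_max.
exists (B1 + B2) => [|u]; first by rewrite addr_gt0.
by rewrite (le_trans (ler_normD _ _))// lerD.
Qed.

(** Closure for the uniform norm on the whole space: the Bohr almost periodic functions. *)
Definition trig_closure f :=
  forall e, 0 < e -> exists2 g, trigpoly g & forall u, `|f u - g u| <= e.

Lemma trig_closure_poly f : trigpoly f -> trig_closure f.
Proof. by move=> Hf e e0; exists f => // u; rewrite subrr normr0 ltW. Qed.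

Lemma trig_closure_lim f :
  (forall e, 0 < e -> exists2 g, trig_closure g & forall u, `|f u - g u| <= e) ->
  trig_closure f.
Proof.
move=> H e e0; have [g Hg fg] := H _ (divr_gt0 e0 (ltr0n R 2)).
have [h Hh gh] := Hg _ (divr_gt0 e0 (ltr0n R 2)).
exists h => // u; rewrite (splitr e) -(subrKA (g u)).
by rewrite (le_trans (ler_normD _ _))// lerD.
Qed.

Lemma trig_closure_cst c : trig_closure (fun=> c).
Proof.
apply: trig_closure_poly.
rewrite (_ : (fun=> c) = fun u => c * cos (0 + dotv 0 u)).
  exact: trigpoly_cos.
apply/funext => u; rewrite /dotv big1 ?addr0 ?cos0 ?mulr1// => k _.
by rewrite mxE mul0r.
Qed.

Lemma trig_closure_bounded f :
  trig_closure f -> exists2 B, 0 < B & forall u, `|f u| <= B.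
Proof.
move=> /(_ 1 ltr01) [g /trigpoly_bounded[B B0 gB] fg].
exists (1 + B) => [|u]; first by rewrite addr_gt0.
by rewrite -(subrK (g u) (f u)) (le_trans (ler_normD _ _))// lerD.
Qed.

Lemma trig_closureD f g :
  trig_closure f -> trig_closure g -> trig_closure (fun u => f u + g u).
Proof.
move=> Hf Hg e e0; have [f' Hf' ff'] := Hf _ (divr_gt0 e0 (ltr0n R 2)).
have [g' Hg' gg'] := Hg _ (divr_gt0 e0 (ltr0n R 2)).
exists (fun u => f' u + g' u); first exact: trigpolyD.
by move=> u; rewrite opprD addrACA (splitr e) (le_trans (ler_normD _ _))// lerD.
Qed.

Lemma trig_closureM f g :
  trig_closure f -> trig_closure g -> trig_closure (fun u => f u * g u).
Proof.
move=> Hf Hg e e0.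
have [B B0 fB] := trig_closure_bounded _ Hf.
have [g' Hg' gg'] := Hg _ (divr_gt0 e0 (mulr_gt0 (ltr0n R 2) B0)).
(* [g'] is fixed before [f'], since the accuracy required of [f'] depends on the bound of [g']. *)
have [C C0 gC] := trigpoly_bounded _ Hg'.
have [f' Hf' ff'] := Hf _ (divr_gt0 e0 (mulr_gt0 (ltr0n R 2) C0)).
exists (fun u => f' u * g' u); first exact: trigpolyM.
move=> u; rewrite (_ : _ - _ = f u * (g u - g' u) + (f u - f' u) * g' u); last by ring.
rewrite (splitr e) (le_trans (ler_normD _ _))// !normrM lerD//.
  rewrite (le_trans (ler_pM _ _ (fB u) (gg' u)))// le_eqVlt; apply/orP; left.
  by apply/eqP; field; rewrite gt_eqF.
rewrite (le_trans (ler_pM _ _ (ff' u) (gC u)))// le_eqVlt; apply/orP; left.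
by apply/eqP; field; rewrite gt_eqF.
Qed.

Lemma trig_closureZ c f : trig_closure f -> trig_closure (fun u => c * f u).
Proof. by apply: trig_closureM; exact: trig_closure_cst. Qed.

Lemma trig_closureX k f : trig_closure f -> trig_closure (fun u => f u ^+ k).
Proof.
move=> Hf; elim: k => [|k IH]; first exact: (trig_closure_cst 1).
rewrite (_ : (fun u => _) = fun u => f u * f u ^+ k).
  exact: trig_closureM.
by apply/funext => u; rewrite exprS.
Qed.

(* Newton-type iteration for the square root of [x ^+ 2]; every iterate is a
   polynomial in [x], and the iterates converge to [`|x|] uniformly on [-1, 1]. *)
Fixpoint abs_poly (n : nat) (x : R) : R :=
  if n is n'.+1 then abs_poly n' x + (x ^+ 2 - abs_poly n' x ^+ 2) / 2 else 0.

(** With [y = |x|], one iteration multiplies the error [y - q] by [1 - (y + q) / 2 <= 1 - y / 2],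
    and [(1 - y / 2) * (1 + (n + 1) * y / 2) <= 1 + n * y / 2]. The third bound is therefore
    preserved; it yields a rate of order [1 / n] uniform in [x], including near 0. *)
Lemma abs_poly_bound n x : `|x| <= 1 ->
  [/\ 0 <= abs_poly n x, abs_poly n x <= `|x| &
      (`|x| - abs_poly n x) * (1 + n%:R * `|x| / 2) <= `|x|].
Proof.
move=> x1; elim: n => [|n [p0 px IH]] /=.
  by rewrite mul0r mul0r addr0 mulr1 subr0.
rewrite -(real_normK (num_real x)) -[n.+1]addn1 natrD.
set y := `|x| in x1 px IH *; set q := abs_poly n x in p0 px IH *.
have n0 : (0 : R) <= n%:R by [].
set N : R := n%:R in n0 IH *.
split; [nra|nra|].
have -> : y - (q + (y ^+ 2 - q ^+ 2) / 2) = (y - q) * (1 - (y + q) / 2) by field.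
apply: le_trans IH; rewrite -mulrA ler_wpM2l ?subr_ge0//.
have : 0 <= N * y by apply: mulr_ge0; lra.
set z := N * y => z0.
have -> : (N + 1) * y / 2 = (z + y) / 2 by rewrite /z; field.
nra.
Qed.

Lemma abs_poly_cvg n x : `|x| <= 1 -> `| `|x| - abs_poly n.+1 x| <= 2 / n.+1%:R.
Proof.
move=> /(abs_poly_bound n.+1)[p0 px H].
rewrite ger0_norm ?subr_ge0// ler_pdivlMr ?ltr0n//.
have n0 : (0 : R) <= n.+1%:R by [].
move: H p0 px n0; set y := `|x|; set q := abs_poly _ _; set N : R := n.+1%:R.
move=> H p0 px n0.
have [y0|y0] := ltP 0 y; last first.
  have -> : y - q = 0 by lra.
  by rewrite mul0r.
rewrite -(ler_pM2r y0).
nra.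
Qed.

(** Once [f] is scaled into [-1, 1], the iterates [abs_poly k] of it stay in the closure, which is
    an algebra, and converge uniformly to its absolute value. This is the lattice step of the
    Stone-Weierstrass theorem. *)
Lemma trig_closure_norm f : trig_closure f -> trig_closure (fun u => `|f u|).
Proof.
move=> Hf; have [B B0 fB] := trig_closure_bounded _ Hf.
rewrite (_ : (fun u => _) = fun u => B * `|B^-1 * f u|); last first.
  apply/funext => u; rewrite normrM gtr0_norm ?invr_gt0//.
  by rewrite mulrA divff ?mul1r// gt_eqF.
apply: trig_closureZ.
pose g u := B^-1 * f u.
have g1 u : `|g u| <= 1.
  by rewrite normrM gtr0_norm ?invr_gt0// mulrC ler_pdivrMr// mul1r.
have {Hf} Hg : trig_closure g := trig_closureZ B^-1 _ Hf.
rewrite -[X in trig_closure X]/(fun u => `|g u|).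
apply: trig_closure_lim => e e0.
have [n ne] : exists n : nat, 2 / n.+1%:R <= e.
  have := archi_boundP (ltW (divr_gt0 (ltr0n R 2) e0)).
  set n := Num.bound _ => ne; exists n.
  rewrite ler_pdivrMr ?ltr0n// mulrC -ler_pdivrMr//.
  by rewrite (le_trans (ltW ne))// ler_nat.
exists (fun u => abs_poly n.+1 (g u)) => [|u]; last first.
  by rewrite (le_trans (abs_poly_cvg _ _ (g1 u))).
elim: n.+1 => [|k IH] /=; first exact: (trig_closure_cst 0).
apply: trig_closureD => //.
rewrite (_ : (fun u => _) =
  fun u => 2^-1 * (g u ^+ 2 + (-1) * abs_poly k (g u) ^+ 2)); last first.
  by apply/funext => u; field.
apply/trig_closureZ/trig_closureD; first exact: trig_closureX.
by apply: trig_closureZ; exact: trig_closureX.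
Qed.

Lemma trig_closure_max f g : trig_closure f -> trig_closure g ->
  trig_closure (fun u => Num.max (f u) (g u)).
Proof.
move=> Hf Hg; rewrite (_ : (fun u => _) =
  fun u => 2^-1 * ((f u + g u) + `|f u + (-1) * g u|)); last first.
  by apply/funext => u; rewrite maxr_absE mulN1r mulrC.
apply: trig_closureZ; apply: trig_closureD; first exact: trig_closureD.
by apply: trig_closure_norm; apply: trig_closureD => //; exact: trig_closureZ.
Qed.

Lemma trig_closure_fmax (I : finType) (i0 : I) (F : I -> 'rV[R]_s -> R) :
  (forall i, trig_closure (F i)) -> trig_closure (fun u => fmax (F ^~ u)).
Proof.
move=> HF; rewrite (_ : (fun u => _) = fun u => \big[Num.max/F i0 u]_i F i u); last first.
  by apply/funext => u; rewrite (fmaxE _ i0).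
elim: (index_enum I) => [|i r IH].
  rewrite (_ : (fun u => _) = F i0)//.
  by apply/funext => u; rewrite big_nil.
rewrite (_ : (fun u => _) =
  fun u => Num.max (F i u) (\big[Num.max/F i0 u]_(i <- r) F i u)).
  exact: trig_closure_max.
by apply/funext => u; rewrite big_cons.
Qed.

Lemma distX_le (x y N : R) k : `|x| <= N -> `|y| <= N ->
  `|x ^+ k.+1 - y ^+ k.+1| <= k.+1%:R * `|x - y| * N ^+ k.
Proof.
move=> xN yN; have N0 : 0 <= N := le_trans (normr_ge0 _) xN.
rewrite subrXX normrM -mulrA mulrCA ler_wpM2l//.
rewrite (le_trans (ler_norm_sum _ _ _))//.
rewrite (@le_trans _ _ (\sum_(i < k.+1) N ^+ k))//; last first.
  by rewrite sumr_const card_ord mulr_natl.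
apply: ler_sum => i _; rewrite normrM !normrX.
rewrite -[X in N ^+ X](subnK (ltn_ord i : (i <= k)%N)) exprD.
by rewrite ler_pM ?exprn_ge0// lerXn2r// nnegrE.
Qed.

(* The maximum of the [w^-1 sin (w u_k)], which is a uniform limit of
   trigonometric polynomials, is within [2 w] times the square of the l1 norm of
   [vmax u]. *)
Lemma vmaxX_trig_approx k e : (0 < s)%N -> 0 < e ->
  exists2 h, trigpoly h & forall u, `|vmax u ^+ k - h u| <= e * expR (normone u).
Proof.
move=> s0 e0; case: k => [|k].
  have [h Hh hb] := trig_closure_cst 1 _ e0; exists h => // u.
  rewrite expr0 (le_trans (hb u))// ler_peMr ?(ltW e0)// -[leLHS]expR0 ler_expR.
  exact: normone_ge0.
(* The factors come from [distX_le], from the distance between the two maxima, and from bounding the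
   power [k.+2] of the l1 norm by its exponential; [w] is chosen so that [K * w = e / 2]. *)
pose K : R := k.+1%:R * 2 * k.+2`!%:R.
have K0 : 0 < K by rewrite !mulr_gt0// ltr0n fact_gt0.
pose w := e / 2 / K.
have w0 : 0 < w by rewrite !divr_gt0.
pose v (u : 'rV[R]_s) j := w^-1 * sin (w * u 0 j).
have Hv : trig_closure (fun u => fmax (v u) ^+ k.+1).
  apply: trig_closureX; apply: (trig_closure_fmax _ (Ordinal s0)) => j.
  apply: trig_closure_poly.
  rewrite (_ : (fun u => _) =
    fun u => w^-1 * cos (- (pi / 2) + dotv (w *: delta_mx 0 j) u)).
    exact: trigpoly_cos.
  by apply/funext => u; rewrite dotvZl dotv_delta addrC cosBpihalf.
have [h Hh hb] := Hv _ (divr_gt0 e0 (ltr0n R 2)).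
exists h => // u.
have exp1 : 1 <= expR (normone u) by rewrite -[leLHS]expR0 ler_expR normone_ge0.
have dist : `|vmax u - fmax (v u)| <= 2 * w * normone u ^+ 2.
  rewrite (le_trans (fmax_dist _ _ (Ordinal s0)))//.
  rewrite (@le_trans _ _ (\sum_j 2 * w * (`|u 0 j| * normone u)))//.
    apply: ler_sum => j _; rewrite /v -(ler_pM2l w0) -[X in X * `|_ - _|](gtr0_norm w0).
    rewrite -normrM mulrBr mulrA divff ?gt_eqF// mul1r distrC.
    rewrite (le_trans (norm_sinB_le2 _))// normrM gtr0_norm// exprMn.
    rewrite [leRHS](_ : _ = 2 * (w ^+ 2 * (`|u 0 j| * normone u))); last by ring.
    rewrite ler_pM2l// ler_pM2l ?exprn_gt0// expr2 ler_wpM2l//.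
    exact: le_normone.
  by rewrite -mulr_sumr -mulr_suml expr2.
have vN : `|fmax (v u)| <= normone u.
  have [j -> _] := fmax_attained (v u) (Ordinal s0).
  rewrite (le_trans _ (le_normone u j))// /v normrM gtr0_norm ?invr_gt0//.
  rewrite mulrC ler_pdivrMr// (le_trans (norm_sin_le _))// normrM gtr0_norm//.
  by rewrite mulrC.
have step1 : `|vmax u ^+ k.+1 - fmax (v u) ^+ k.+1| <= e / 2 * expR (normone u).
  rewrite (le_trans (distX_le _ _ _ k (norm_vmax_le u s0) vN))//.
  rewrite (@le_trans _ _ (k.+1%:R * (2 * w * normone u ^+ 2) * normone u ^+ k))//.
    by rewrite ler_wpM2r ?exprn_ge0 ?normone_ge0// ler_wpM2l.
  rewrite (_ : _ * _ = k.+1%:R * 2 * w * normone u ^+ k.+2); last by rewrite !exprS; ring.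
  rewrite (le_trans (ler_wpM2l _ (normone_exp_le u k.+2)))//.
    by apply: mulr_ge0 => //; exact: ltW.
  rewrite mulrA ler_wpM2r ?expR_ge0// /w le_eqVlt; apply/orP; left; apply/eqP.
  by rewrite mulrAC -/K mulrC divfK// gt_eqF.
rewrite -(subrKA (fmax (v u) ^+ k.+1)) (le_trans (ler_normD _ _))//.
rewrite [in leRHS](splitr e) mulrDl lerD//.
by rewrite (le_trans (hb u))// ler_peMr// divr_ge0// ltW.
Qed.

End TrigApproximation.

(** * Expectation over i.i.d. words *)

Section InverseSqrt.
Context {R : realType}.

(** The small parameter of all expansions; it takes the value 0 at [n = 0]. *)
Definition isqrt (n : nat) : R := (Num.sqrt n%:R)^-1.

Lemma isqrt_ge0 n : 0 <= isqrt n.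
Proof. by rewrite invr_ge0 sqrtr_ge0. Qed.

Lemma isqrt_gt0 n : (0 < n)%N -> 0 < isqrt n.
Proof. by move=> n0; rewrite invr_gt0 sqrtr_gt0 ltr0n. Qed.

Lemma isqrt_sqr n : isqrt n ^+ 2 = n%:R^-1.
Proof. by rewrite exprVn sqr_sqrtr. Qed.

Lemma isqrt_le1 n : isqrt n <= 1.
Proof.
case: n => [|n]; first by rewrite /isqrt sqrtr0 invr0.
by rewrite invf_le1 ?sqrtr_gt0 ?ltr0n// -[leLHS]sqrtr1 ler_sqrt ?ler1n ?ltr0n.
Qed.

Lemma cvg_isqrt : isqrt n @[n --> \oo] --> (0 : R).
Proof.
apply/cvgrPdist_le => e e0; near=> n.
rewrite sub0r normrN ger0_norm ?isqrt_ge0//.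
rewrite -(@ler_pXn2r _ 2) ?nnegrE ?isqrt_ge0 ?(ltW e0)// isqrt_sqr.
have : (e ^+ 2)^-1 <= n%:R by near: n; exact: nbhs_infty_ger.
move=> en; have e20 : 0 < e ^+ 2 by rewrite exprn_gt0.
by rewrite invf_ple ?posrE//; apply: lt_le_trans en; rewrite invr_gt0.
Unshelve. all: by end_near. Qed.

Lemma cvg_le_isqrt (u : nat -> R) l K :
  (forall n, (0 < n)%N -> `|u n - l| <= K * isqrt n) -> u n @[n --> \oo] --> l.
Proof.
move=> H; apply/cvgrPdist_le => e e0.
have H0 : K * isqrt n @[n --> \oo] --> 0.
  by rewrite -(mulr0 K); apply: cvgM; [exact: cvg_cst|exact: cvg_isqrt].
move/cvgrPdist_le : H0 => /(_ _ e0) H0; near=> n.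
have n0 : (0 < n)%N by near: n; exact: nbhs_infty_gt.
rewrite distrC (le_trans (H n n0))// (le_trans (ler_norm _))//.
by rewrite -normrN -sub0r; near: n.
Unshelve. all: by end_near. Qed.

End InverseSqrt.

(** * Finite sums over words, and the central limit theorem for cosines *)

Section WordExpectation.
Context {R : realType} {m : nat} (p : 'I_m -> R).
Hypotheses (hp0 : forall i, 0 <= p i) (hp1 : \sum_i p i = 1).
Implicit Types (g h : seq 'I_m -> R) (z : 'I_m -> R).

(** The expectation of [g] over words of [n] independent letters of law [p], as an iterated finite
    sum: no measurability or integrability is involved. *)
Fixpoint wexp (n : nat) g : R :=
  if n is n'.+1 then \sum_i p i * wexp n' (fun t => g (i :: t)) else g [::].

Lemma wexpD n g h : wexp n (fun t => g t + h t) = wexp n g + wexp n h.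
Proof.
elim: n g h => //= n IH g h.
by rewrite -big_split/=; apply: eq_bigr => i _; rewrite IH mulrDr.
Qed.

Lemma wexpZ n c g : wexp n (fun t => c * g t) = c * wexp n g.
Proof.
elim: n g => //= n IH g.
by rewrite mulr_sumr; apply: eq_bigr => i _; rewrite IH mulrCA.
Qed.

Lemma wexpB n g h : wexp n (fun t => g t - h t) = wexp n g - wexp n h.
Proof.
under [X in wexp n X]eq_fun do rewrite -mulN1r.
by rewrite wexpD wexpZ mulN1r.
Qed.

Lemma wexp_sum n (I : Type) (r : seq I) (F : I -> seq 'I_m -> R) :
  wexp n (fun t => \sum_(i <- r) F i t) = \sum_(i <- r) wexp n (F i).
Proof.
elim: r => [|i r IH].
  under [X in wexp n X]eq_fun do rewrite big_nil -[0](mul0r 0).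
  by rewrite wexpZ mul0r big_nil.
under [X in wexp n X]eq_fun do rewrite big_cons.
by rewrite wexpD IH big_cons.
Qed.

Lemma wexp_cst n c : wexp n (fun=> c) = c.
Proof. by elim: n => //= n ->; rewrite -mulr_suml hp1 mul1r. Qed.

Lemma wexp_le n g h : (forall t, size t = n -> g t <= h t) -> wexp n g <= wexp n h.
Proof.
elim: n g h => /= [|n IH] g h gh; first exact: gh.
apply: ler_sum => i _; rewrite ler_wpM2l// IH// => t st.
by apply: gh; rewrite /= st.
Qed.

Lemma wexp_dist_le n g h e : (forall t, size t = n -> `|g t - h t| <= e t) ->
  `|wexp n g - wexp n h| <= wexp n e.
Proof.
move=> H; rewrite ler_norml; apply/andP; split.
  rewrite -mulN1r -wexpZ -wexpB wexp_le// => t st.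
  by have := H t st; rewrite ler_norml mulN1r => /andP[].
rewrite -wexpB wexp_le// => t st.
by have := H t st; rewrite ler_norml => /andP[].
Qed.

Lemma wexp_expR n c z :
  wexp n (fun t => expR (c * \sum_(i <- t) z i)) = (\sum_i p i * expR (c * z i)) ^+ n.
Proof.
elim: n => [|n IH] /=; first by rewrite big_nil mulr0 expR0 expr0.
rewrite exprS mulr_suml; apply: eq_bigr => i _.
under [X in wexp n X]eq_fun do rewrite big_cons mulrDr expRD.
by rewrite wexpZ IH mulrA.
Qed.

(** By independence the expectation is an [n]-th power. As [z] is centered, the one-letter factor at
    [c = isqrt n] is at most [1 + K * c ^+ 2 <= expR (K * c ^+ 2)], whose [n]-th power is
    [expR K]. *)
Lemma wexp_mgf_bounded z : \sum_i p i * z i = 0 ->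
  exists2 C, 0 < C & forall n, (0 < n)%N ->
    wexp n (fun t => expR (isqrt n * \sum_(i <- t) z i)) <= C.
Proof.
move=> z0; pose B := \sum_i `|z i|; pose K := expR B * B ^+ 2.
have zB i : `|z i| <= B by rewrite /B (bigD1 i)//= lerDl sumr_ge0.
exists (expR K) => [|n n0]; first exact: expR_gt0.
rewrite wexp_expR.
have -> : expR K = expR (K * isqrt n ^+ 2) ^+ n.
  by rewrite -expRM_natl mulrCA isqrt_sqr divff ?mulr1// pnatr_eq0 -lt0n.
apply: lerXn2r; rewrite ?nnegrE ?expR_ge0//.
  by apply: sumr_ge0 => i _; rewrite mulr_ge0 ?expR_ge0.
apply: le_trans (expR_ge1Dx _).
rewrite (@le_trans _ _ (\sum_i p i * (1 + isqrt n * z i + K * isqrt n ^+ 2)))//.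
  apply: ler_sum => i _; rewrite ler_wpM2l//.
  have zi : `|isqrt n * z i| <= B.
    rewrite normrM ger0_norm ?isqrt_ge0// (le_trans _ (zB i))//.
    by rewrite ler_piMl// isqrt_le1.
  have := expR_taylor2 _ _ zi.
  rewrite ler_norml => /andP[_ H].
  rewrite -lerBlDl opprD addrA (le_trans H)// /K -mulrA ler_wpM2l ?expR_ge0//.
  rewrite normrM exprMn mulrC (ger0_norm (isqrt_ge0 n)) ler_wpM2r ?exprn_ge0 ?isqrt_ge0//.
  by rewrite lerXn2r ?nnegrE// (le_trans _ (zB i)).
under eq_bigr do rewrite 2!mulrDr mulr1 mulrCA.
by rewrite !big_split/= hp1 -mulr_sumr z0 mulr0 addr0 -mulr_suml hp1 mul1r.
Qed.

(** Letters are averaged out one at a time, each being replaced by the factor [q] at cost [e]; these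
    costs are not amplified because [q <= 1]. The one-letter estimate is needed for every phase,
    since the letter just read is moved into the phase. *)
Lemma wexp_cos_pow (x : 'I_m -> R) q e : 0 <= q <= 1 ->
  (forall t, `|\sum_i p i * cos (t + x i) - q * cos t| <= e) ->
  forall n t, `|wexp n (fun w => cos (t + \sum_(i <- w) x i)) - q ^+ n * cos t|
              <= n%:R * e.
Proof.
move=> /andP[q0 q1] H; elim=> [|n IH] t /=.
  by rewrite big_nil addr0 expr0 mul1r subrr normr0 mul0r.
have -> : \sum_i p i * wexp n (fun w => cos (t + \sum_(j <- i :: w) x j)) - q ^+ n.+1 * cos t =
  \sum_i p i * (wexp n (fun w => cos ((t + x i) + \sum_(j <- w) x j)) - q ^+ n * cos (t + x i))
  + q ^+ n * (\sum_i p i * cos (t + x i) - q * cos t).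
  rewrite mulrBr mulr_sumr addrA exprSr mulrA -big_split/=; congr (_ - _).
  apply: eq_bigr => i _; rewrite mulrBr mulrCA subrK; congr (_ * wexp n _).
  by apply/funext => w; rewrite big_cons addrA.
rewrite (le_trans (ler_normD _ _))// -natr1 mulrDl mul1r lerD//.
  rewrite (le_trans (ler_norm_sum _ _ _))//.
  rewrite (@le_trans _ _ (\sum_i p i * (n%:R * e)))//; last first.
    by rewrite -mulr_suml hp1 mul1r.
  by apply: ler_sum => i _; rewrite normrM ger0_norm// ler_wpM2l.
rewrite normrM ger0_norm ?exprn_ge0// (le_trans _ (H t))//.
by rewrite ler_piMl// exprn_ile1.
Qed.

(** With [c = isqrt n], averaging over one letter multiplies the cosine by
    [expR (- (c ^+ 2 * v / 2))] up to [K * c ^+ 3]: the linear Taylor term vanishes because [z] is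
    centered, and the quadratic terms agree. Over [n] letters the error is [K * c]. *)
Lemma wexp_cos_cvg z t : \sum_i p i * z i = 0 ->
  wexp n (fun w => cos (t + isqrt n * \sum_(i <- w) z i)) @[n --> \oo] -->
  cos t * expR (- (\sum_i p i * z i ^+ 2) / 2).
Proof.
move=> z0; set v := \sum_i _.
have v0 : 0 <= v by apply: sumr_ge0 => i _; rewrite mulr_ge0 ?sqr_ge0.
pose B := \sum_i `|z i|.
have B0 : 0 <= B by exact: sumr_ge0.
have zB i : `|z i| <= B by rewrite /B (bigD1 i)//= lerDl sumr_ge0.
pose K := B ^+ 3 + B ^+ 4 + v ^+ 2.
apply: (cvg_le_isqrt _ _ K) => n n0; set c := isqrt n.
have c0 : 0 <= c := isqrt_ge0 n.
have c1 : c <= 1 := isqrt_le1 n.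
have nc2 : n%:R * c ^+ 2 = 1 by rewrite isqrt_sqr divff// pnatr_eq0 -lt0n.
pose q := expR (- (c ^+ 2 * v / 2)).
have q01 : 0 <= q <= 1.
  by rewrite expR_ge0 expR_le1 oppr_le0 divr_ge0// mulr_ge0// exprn_ge0.
have -> : cos t * expR (- v / 2) = q ^+ n * cos t.
  rewrite mulrC -expRM_natl; congr (expR _ * _).
  by transitivity (- ((n%:R * c ^+ 2) * v) / 2); [rewrite nc2 mul1r|ring].
under [X in wexp n X]eq_fun do rewrite mulr_sumr.
have -> : K * c = n%:R * (c ^+ 3 * K).
  by transitivity ((n%:R * c ^+ 2) * (K * c)); [rewrite nc2 mul1r|ring].
apply: wexp_cos_pow => // {}t.
have -> : \sum_i p i * cos (t + c * z i) - q * cos t =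
  \sum_i p i * (cos (t + c * z i) -
       (cos t * (1 - (c * z i) ^+ 2 / 2) - sin t * (c * z i)))
  - cos t * (q - (1 - c ^+ 2 * v / 2)).
  have : \sum_i p i * (cos t * (1 - (c * z i) ^+ 2 / 2) - sin t * (c * z i)) =
         cos t * (1 - c ^+ 2 * v / 2).
    transitivity (\sum_i (cos t * p i - cos t * (c ^+ 2 / 2) * (p i * z i ^+ 2) -
                          sin t * c * (p i * z i))).
      by apply: eq_bigr => i _; ring.
    rewrite !sumrB -!mulr_sumr hp1 z0 -/v; ring.
  under [\sum_i p i * (_ - (_ - _))]eq_bigr do rewrite mulrBr.
  by rewrite sumrB => ->; ring.
rewrite (le_trans (ler_normB _ _))// /K [leRHS]mulrDr lerD//.
  rewrite (le_trans (ler_norm_sum _ _ _))//.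
  rewrite (@le_trans _ _ (\sum_i p i * (c ^+ 3 * (B ^+ 3 + B ^+ 4))))//; last first.
    by rewrite -mulr_suml hp1 mul1r.
  apply: ler_sum => i _; rewrite normrM (ger0_norm (hp0 i)) ler_wpM2l//.
  rewrite (le_trans (cos_taylor2 _ _))// [leRHS]mulrDr normrM !exprMn (ger0_norm c0).
  rewrite lerD// ler_pM ?exprn_ge0//.
  - by rewrite lerXn2r ?nnegrE.
  - by rewrite -[leLHS]mulr1 [in leLHS]exprSr -mulrA ler_piMr ?exprn_ge0// mulr1.
  - by rewrite lerXn2r ?nnegrE.
rewrite normrM (@le_trans _ _ (1 * (c ^+ 2 * v / 2) ^+ 2))//.
  rewrite ler_pM ?cos_max// expRN_taylor// divr_ge0// mulr_ge0// exprn_ge0//.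
rewrite mul1r; have v20 : 0 <= v ^+ 2 by exact: sqr_ge0.
have c30 : 0 <= c ^+ 3 by rewrite exprn_ge0.
have -> : (c ^+ 2 * v / 2) ^+ 2 = c ^+ 3 * (c * v ^+ 2) / 4 by field.
rewrite ler_pdivrMr// -[leRHS]mulrA ler_wpM2l//.
nra.
Qed.

End WordExpectation.

(** * The characteristic function of the normal law *)

Section NormalDensity.
Context {R : realType} (sigma : R).
Hypothesis sigma0 : 0 < sigma.
Local Notation mu := (@lebesgue_measure R).
Local Notation nu := (@normal_prob R 0 sigma).

(** The Radon-Nikodym derivative of the normal law agrees almost everywhere with [normal_pdf], as
    both have the same integral over every measurable set. *)
Lemma ge0_integral_normal_prob (g : R -> R) : measurable_fun setT g ->
  (forall x, 0 <= g x) ->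
  (\int[nu]_x (g x)%:E = \int[mu]_x (g x * normal_pdf 0 sigma x)%:E)%E.
Proof.
move=> mg g0; have dom := normal_prob_dominates 0 sigma.
rewrite -(Radon_Nikodym_SigmaFinite.change_of_variables dom)//; last by exact/measurable_EFinP.
under [RHS]eq_integral do rewrite EFinM.
have fi := Radon_Nikodym_SigmaFinite.f_integrable dom.
apply: ae_eq_integral => //.
- apply: emeasurable_funM; first exact/measurable_EFinP.
  exact: measurable_int fi.
- apply: emeasurable_funM; first exact/measurable_EFinP.
  by apply/measurable_EFinP; exact: measurable_normal_pdf.
- apply: ae_eqe_mul2l; apply: integral_ae_eq => //.
    by apply/measurable_EFinP; exact: measurable_normal_pdf.
  by move=> E _ mE; rewrite -(Radon_Nikodym_SigmaFinite.f_integral dom).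
Qed.

(** Completing the square: exponential tilting translates a normal density. *)
Lemma normal_pdf_shift s x :
  expR (s * x - s ^+ 2 * sigma ^+ 2 / 2) * normal_pdf 0 sigma x =
  normal_pdf 0 sigma (x - s * sigma ^+ 2).
Proof.
rewrite normal_pdfE ?gt_eqF//= mulrCA; congr (_ * _).
rewrite /normal_fun -expRD; congr expR; field; rewrite gt_eqF//.
Qed.

(** The one-dimensional Cameron-Martin formula, obtained by translating the variable of
    integration. *)
Lemma ge0_integral_normal_shift (g : R -> R) s : continuous g ->
  (forall x, 0 <= g x) ->
  (\int[nu]_x (g x)%:E =
   \int[nu]_x (g (x - s * sigma ^+ 2) *
               expR (s * x - s ^+ 2 * sigma ^+ 2 / 2))%:E)%E.
Proof.
move=> cg g0; set c := (s * sigma ^+ 2).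
have cF : continuous (fun x : R => x - c).
  by move=> x; apply: cvgB; [exact: cvg_id|exact: cvg_cst].
have F' : (fun x : R => x - c)^`()%classic = cst 1.
  apply/funext => x; rewrite derive1E deriveB// derive_id derive_cst.
  by rewrite subr0.
have cp : continuous (normal_pdf 0 sigma).
  by apply: continuous_normal_pdf; rewrite gt_eqF.
rewrite !ge0_integral_normal_prob//; last first.
- exact: continuous_measurable_fun.
- by move=> x; rewrite mulr_ge0 ?expR_ge0.
- apply: measurable_funM.
    apply: measurableT_comp; last exact: measurable_funB.
    exact: continuous_measurable_fun.
  by apply: measurableT_comp => //; apply: measurable_funB.
rewrite (@increasing_ge0_integration_by_substitutionT R (fun x => x - c)
           (fun x => g x * normal_pdf 0 sigma x)).
- apply: eq_integral => x _; rewrite F' /=; congr EFin.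
  by rewrite /= mulr1 -mulrA normal_pdf_shift.
- by move=> x y xy; rewrite ltrD2r.
- by rewrite F' => ?; exact: cvg_cst.
- by rewrite F'; exact: is_cvg_cst.
- by rewrite F'; exact: is_cvg_cst.
- by move=> x; apply: derivableB.
- exact: cvg_addrr_Ny.
- exact: cvg_addrr.
- by move=> x; apply: cvgM; [exact: cg|exact: cp].
- by move=> x; rewrite mulr_ge0// normal_pdf_ge0.
Qed.

End NormalDensity.

(** * Integrability of real functions on a probability space *)

Section IntegrableFunctions.
Context {R : realType} {d} {T : measurableType d} (P : probability T R).
Implicit Types X Y : T -> R.

Lemma meanE X : mean P X = \int[P]_w X w.
Proof. by rewrite /mean unlock. Qed.

Lemma integrable_dominated X Y : measurable_fun setT X ->
  P.-integrable setT (EFin \o Y) -> (forall w, `|X w| <= Y w) ->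
  P.-integrable setT (EFin \o X).
Proof.
move=> mX iY XY; apply: (le_integrable measurableT _ _ iY).
  exact/measurable_EFinP.
by move=> w _ /=; rewrite lee_fin (le_trans (XY w))// ler_norm.
Qed.

Lemma integrableZ c X : P.-integrable setT (EFin \o X) ->
  P.-integrable setT (EFin \o (fun w => c * X w)).
Proof.
move=> iX; rewrite (_ : _ \o _ = fun w => (c%:E * (EFin \o X) w)%E).
  exact: integrableZl.
by apply/funext => w; rewrite /= EFinM.
Qed.

Lemma integrable_add X Y : P.-integrable setT (EFin \o X) ->
  P.-integrable setT (EFin \o Y) ->
  P.-integrable setT (EFin \o (fun w => X w + Y w)).
Proof.
move=> iX iY; rewrite (_ : _ \o _ = (EFin \o X) \+ (EFin \o Y))%E.
  exact: integrableD.
by apply/funext => w; rewrite /= EFinD.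
Qed.

Lemma integrable_const (c : R) : P.-integrable setT (EFin \o (fun=> c)).
Proof.
exact: finite_measure_integrable_cst.
Qed.

Lemma Rintegral_const (c : R) : \int[P]_w c = c.
Proof. by rewrite Rintegral_cst//= probability_setT mulr1. Qed.

End IntegrableFunctions.
Arguments integrable_dominated {R d T P X Y}.

(** * The characteristic function from Stein's identity *)

Section GaussianCosine.
Context {R : realType} {d} {T : measurableType d} (P : probability T R).
Context (sigma : R) (X : T -> R).
Hypotheses (sigma0 : 0 < sigma) (mX : measurable_fun setT X).
Hypothesis lawX :
  forall B, measurable B -> P (X @^-1` B) = normal_prob 0 sigma B.
Let v := sigma ^+ 2.

Let v0 : 0 <= v. Proof. exact: sqr_ge0. Qed.

Lemma ge0_integral_gaussian (g : R -> R) : measurable_fun setT g ->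
  (forall x, 0 <= g x) ->
  (\int[P]_w (g (X w))%:E = \int[normal_prob 0 sigma]_x (g x)%:E)%E.
Proof.
move=> mg g0.
pose X0 : T -> measurableTypeR R := X.
have mX0 : measurable_fun setT X0 by exact: mX.
pose X' : {RV P >-> measurableTypeR R} := HB.pack X0 (isMeasurableFun.Build _ _ _ _ X0 mX0).
transitivity (\int[distribution P X']_x (g x)%:E)%E; last first.
  by apply: eq_measure_integral => A mA _; exact: lawX.
by rewrite ge0_integral_distribution//; exact/measurable_EFinP.
Qed.

Lemma ge0_integral_gaussian_shift (g : R -> R) s : continuous g ->
  (forall x, 0 <= g x) ->
  (\int[P]_w (g (X w))%:E =
   \int[P]_w (g (X w - s * v) * expR (s * X w - s ^+ 2 * v / 2))%:E)%E.
Proof.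
move=> cg g0; rewrite ge0_integral_gaussian//; last exact: continuous_measurable_fun.
rewrite (ge0_integral_normal_shift _ sigma0 _ s)// -ge0_integral_gaussian//.
  apply: measurable_funM.
    apply: measurableT_comp; last exact: measurable_funB.
    exact: continuous_measurable_fun.
  by apply: measurableT_comp => //; apply: measurable_funB.
by move=> x; rewrite mulr_ge0 ?expR_ge0.
Qed.

Let measurable_shift_exp s :
  measurable_fun setT (fun w => expR (s * X w - s ^+ 2 * v / 2)).
Proof.
apply: measurableT_comp => //; apply: measurable_funB => //.
exact: measurable_funM.
Qed.

(** The shift identity for the constant function 1, whose integral is finite. *)
Lemma integrable_shift_exp s :
  P.-integrable setT (EFin \o (fun w => expR (s * X w - s ^+ 2 * v / 2))).
Proof.
apply/integrableP; split; first exact/measurable_EFinP.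
under eq_integral do rewrite /= ger0_norm ?expR_ge0// -[expR _]mul1r.
rewrite -(@ge0_integral_gaussian_shift (fun=> 1) s)//; last first.
  by move=> x; exact: cvg_cst.
by rewrite integral_cst//= probability_setT mule1 ltry.
Qed.

Lemma Rintegral_shift_exp s :
  \int[P]_w expR (s * X w - s ^+ 2 * v / 2) = 1.
Proof.
rewrite /Rintegral; under eq_integral do rewrite -[expR _]mul1r.
rewrite -(@ge0_integral_gaussian_shift (fun=> 1) s)//; last first.
  by move=> x; exact: cvg_cst.
by rewrite integral_cst//= probability_setT mule1.
Qed.

Lemma integrable_gaussian_exp s :
  P.-integrable setT (EFin \o (fun w => expR (s * X w))).
Proof.
rewrite (_ : (fun w => _) = fun w =>
    expR (s ^+ 2 * v / 2) * expR (s * X w - s ^+ 2 * v / 2)).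
  exact/integrableZ/integrable_shift_exp.
by apply/funext => w; rewrite -expRD addrC subrK.
Qed.

(** One integrable majorant serves every differentiation under the integral. The factor 2 leaves one
    [expR |X|] for the polynomial terms and one for the tilting exponential. *)
Let G w := expR (2 * X w) + expR (- 2 * X w).

Let integrable_G : P.-integrable setT (EFin \o G).
Proof. by apply: integrable_add; exact: integrable_gaussian_exp. Qed.

Let exp_le_G w : expR (2 * `|X w|) <= G w.
Proof.
rewrite /G; have [x0|x0] := leP 0 (X w).
  by rewrite ger0_norm// lerDl expR_ge0.
by rewrite ltr0_norm// mulrN mulNr lerDr expR_ge0.
Qed.

Let G_ge0 w : 0 <= G w.
Proof. exact: le_trans (expR_ge0 _) (exp_le_G w). Qed.

Let G_ge1 w : 1 <= G w.
Proof.
by rewrite (le_trans _ (exp_le_G w))// -[leLHS]expR0 ler_expR mulr_ge0.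
Qed.

Let absX_le_exp w : `|X w| <= expR `|X w|.
Proof. by rewrite (le_trans _ (expR_ge1Dx _))// lerDr. Qed.

Let absX_le_G w : `|X w| <= G w.
Proof.
rewrite (le_trans (absX_le_exp w))// (le_trans _ (exp_le_G w))// ler_expR.
by rewrite ler_peMl// ler1n.
Qed.

Let measurable_cosX th t c : measurable_fun setT (fun w => cos (th + t * (X w - c))).
Proof.
apply: measurableT_comp; first exact: continuous_measurable_fun (@continuous_cos R).
apply: measurable_funD => //; apply: measurable_funM => //.
exact: measurable_funB.
Qed.

Let integrable_cosX th t : P.-integrable setT (EFin \o (fun w => cos (th + t * X w))).
Proof.
apply: integrable_dominated integrable_G _ => [|w].
  have := measurable_cosX th t 0; congr measurable_fun.
  by apply/funext => w; rewrite subr0.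
exact: le_trans (cos_max _) (G_ge1 w).
Qed.

Let integrable_shift_cos th t s : P.-integrable setT (EFin \o (fun w =>
  cos (th + t * (X w - s * v)) * expR (s * X w - s ^+ 2 * v / 2))).
Proof.
apply: integrable_dominated (integrable_shift_exp s) _ => [|w].
  exact: measurable_funM.
by rewrite normrM [X in _ * X]ger0_norm ?expR_ge0// ler_piMl ?expR_ge0// cos_max.
Qed.

Lemma Rintegral_shift_cos th t s :
  \int[P]_w cos (th + t * X w) =
  \int[P]_w (cos (th + t * (X w - s * v)) * expR (s * X w - s ^+ 2 * v / 2)).
Proof.
(* The shift identity holds for nonnegative functions, hence the added 1; it contributes 1 to both
   sides and cancels. *)
have cg : continuous (fun x : R => 1 + cos (th + t * x)).
  move=> x; apply: cvgD; first exact: cvg_cst.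
  apply: continuous_comp; last exact: continuous_cos.
  apply: cvgD; first exact: cvg_cst.
  by apply: cvgM; [exact: cvg_cst|exact: cvg_id].
have g0 (x : R) : 0 <= 1 + cos (th + t * x) by have := cos_geN1 (th + t * x); lra.
have := congr1 fine (ge0_integral_gaussian_shift _ s cg g0).
rewrite -!/(Rintegral _ _ _) RintegralD//; last exact: integrable_const.
under [RHS]eq_Rintegral do rewrite mulrDl mul1r.
rewrite RintegralD//; last exact: integrable_shift_exp.
by rewrite Rintegral_const Rintegral_shift_exp => /addrI.
Qed.

(* Derivative at [s = 0] of the shift identity, whose left-hand side does not
   depend on [s]. *)
Lemma Rintegral_stein th t :
  \int[P]_w (t * v * sin (th + t * X w) + X w * cos (th + t * X w)) = 0.
Proof.
pose f s w := cos (th + t * (X w - s * v)) * expR (s * X w - s ^+ 2 * v / 2).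
pose df s w := (t * v * sin (th + t * (X w - s * v)) +
                (X w - s * v) * cos (th + t * (X w - s * v))) *
               expR (s * X w - s ^+ 2 * v / 2).
have dfE (y : R) (w : T) : is_derive y (1 : R) (f ^~ w) (df y w).
  apply: is_derive_eq; rewrite /GRing.scale/= /df.
  by move: (X w) (expR _) (sin _) (cos _) => ? ? ? ?; field.
have derf (s : R) (w : T) : partial1of2 f s w = df s w.
  by rewrite partial1of2E; have [_ ->] := dfE s w.
have cst_f s : \int[P]_w f s w = \int[P]_w cos (th + t * X w).
  by rewrite (Rintegral_shift_cos th t s).
have It : [set` `](-1 : R), 1[] 0 by rewrite /= in_itv/= ltrN10 ltr01.
have h1 s : [set` `](-1 : R), 1[] s -> P.-integrable setT (EFin \o f s).
  by move=> _; exact: integrable_shift_cos.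
have h2 s w : [set` `](-1 : R), 1[] s -> setT w -> derivable (f ^~ w) s 1.
  by move=> _ _; have [] := dfE s w.
pose K := `|t| * v + 1 + v.
have K0 : 0 <= K by rewrite !addr_ge0// mulr_ge0.
have h3 w : 0 <= K * G w by rewrite mulr_ge0.
have h4 : P.-integrable setT (EFin \o (fun w => K * G w)) by exact: integrableZ.
have h5 s w : [set` `](-1 : R), 1[] s -> setT w -> `|partial1of2 f s w| <= K * G w.
  move=> /=; rewrite in_itv/= => /andP[s1 s2] _; rewrite derf /df normrM.
  have sle1 : `|s| <= 1 by rewrite ler_norml !ltW.
  have e1 : `|expR (s * X w - s ^+ 2 * v / 2)| <= expR `|X w|.
    rewrite ger0_norm ?expR_ge0// ler_expR.
    rewrite (@le_trans _ _ (s * X w))//.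
      by rewrite lerBlDr lerDl divr_ge0// mulr_ge0// sqr_ge0.
    by rewrite (le_trans (ler_norm _))// normrM ler_piMl.
  have e2 : `|t * v * sin (th + t * (X w - s * v)) +
                  (X w - s * v) * cos (th + t * (X w - s * v))| <=
            (`|t| * v + 1 + v) * expR `|X w|.
    have E1 : 1 <= expR `|X w| by rewrite -[leLHS]expR0 ler_expR.
    rewrite (@le_trans _ _ (`|t| * v + (`|X w| + v)))//.
      rewrite (le_trans (ler_normD _ _))// lerD//.
        by rewrite normrM [`|t * v|]normrM (ger0_norm v0) ler_piMr ?sin_max// mulr_ge0.
      rewrite normrM (@le_trans _ _ `|X w - s * v|)//.
        by rewrite ler_piMr// cos_max.
      rewrite (le_trans (ler_normB _ _))// lerD// normrM (ger0_norm v0).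
      by rewrite ler_piMl.
    have tv0 : 0 <= `|t| * v by rewrite mulr_ge0.
    have := absX_le_exp w; move: v0; nra.
  rewrite (le_trans (ler_pM _ _ e2 e1))// -mulrA ler_wpM2l//.
  by rewrite -expRD (le_trans _ (exp_le_G w))// ler_expR mulr_natl mulr2n.
have := differentiation_under_integral measurableT It h1 h2 h3 h4 h5.
rewrite (_ : (fun x => _) = cst (\int[P]_w cos (th + t * X w))); last first.
  by apply/funext => s; rewrite cst_f.
rewrite derive1_cst => ->; apply: eq_Rintegral => w _; rewrite derf /df.
by rewrite !mul0r expr0n/= !mul0r !subr0 expR0 mulr1.
Qed.

Let phi th t := \int[P]_w cos (th + t * X w).

(** Differentiating under the integral gives the integral of [- X * sin]; Stein's identity at phase
    [th + pi / 2] turns it back into a multiple of [phi]. *)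
Let is_derive_phi (th t : R) : is_derive t (1 : R) (phi th) (- t * v * phi th t).
Proof.
pose f s w := cos (th + s * X w).
have dfE (s : R) (w : T) : is_derive s (1 : R) (f ^~ w) (- (X w * sin (th + s * X w))).
  apply: is_derive_eq; rewrite /GRing.scale/=.
  by move: (X w) (sin _) => ? ?; ring.
have derf (s : R) (w : T) : partial1of2 f s w = - (X w * sin (th + s * X w)).
  by rewrite partial1of2E; have [_ ->] := dfE s w.
have It : [set` `]t - 1, t + 1[] t by rewrite /= in_itv/= ltrBlDr ltrDl ltr01.
have h1 s : [set` `]t - 1, t + 1[] s -> P.-integrable setT (EFin \o f s).
  by move=> _; exact: integrable_cosX.
have h2 s w : [set` `]t - 1, t + 1[] s -> setT w -> derivable (f ^~ w) s 1.
  by move=> _ _; have [] := dfE s w.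
have h3 s w : [set` `]t - 1, t + 1[] s -> setT w -> `|partial1of2 f s w| <= G w.
  move=> _ _; rewrite derf normrN normrM (le_trans _ (absX_le_G w))//.
  by rewrite ler_piMr// sin_max.
apply: DeriveDef.
  exact: (derivable_under_integral measurableT It h1 h2 G_ge0 integrable_G h3).
rewrite -derive1E.
rewrite (differentiation_under_integral measurableT It h1 h2 G_ge0 integrable_G h3).
under eq_Rintegral do rewrite derf.
have := Rintegral_stein (th + pi / 2) t.
under eq_Rintegral do rewrite addrAC sinDpihalf cosDpihalf.
have mX2 : measurable_fun setT (fun w => - (X w * sin (th + t * X w))).
  apply: measurableT_comp => //; apply: measurable_funM => //.
  apply: measurableT_comp; first exact: continuous_measurable_fun (@continuous_sin R).
  by apply: measurable_funD => //; apply: measurable_funM.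
have iX : P.-integrable setT (EFin \o (fun w => - (X w * sin (th + t * X w)))).
  apply: integrable_dominated mX2 integrable_G _ => w.
  by rewrite normrN normrM (le_trans _ (absX_le_G w))// ler_piMr// sin_max.
under eq_Rintegral do rewrite mulrN.
rewrite RintegralD//; last exact: integrableZ.
rewrite RintegralZl//; rewrite /phi => H.
by move/eqP: H; rewrite addrC addr_eq0 -!mulNr => /eqP.
Qed.

(** By the differential equation for [phi], the product [phi th t * expR (t ^+ 2 * v / 2)] has zero
    derivative in [t], so it keeps its value [cos th] at 0. *)
Lemma Rintegral_gaussian_cos th t :
  \int[P]_w cos (th + t * X w) = cos th * expR (- (t ^+ 2 * v / 2)).
Proof.
have := @is_derive_0_is_cst R (fun t => phi th t * expR (t ^+ 2 * v / 2)) t 0.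
rewrite expr0n/= !mul0r expR0 mulr1 => H0.
have phi0 : phi th 0 = cos th.
  rewrite /phi; under eq_Rintegral do rewrite mul0r addr0.
  exact: Rintegral_const.
have H x : is_derive x (1 : R) (fun t => phi th t * expR (t ^+ 2 * v / 2)) 0.
  have := is_derive_phi th x => dphi.
  by apply: is_derive_eq; rewrite /GRing.scale/=; field.
transitivity (phi th t * expR (t ^+ 2 * v / 2) * expR (- (t ^+ 2 * v / 2))).
  by rewrite -mulrA -expRD subrr expR0 mulr1.
by rewrite (H0 H) phi0.
Qed.

End GaussianCosine.

(** * Convergence of the moments of the maximum *)

Section WordLaw.
Context {R : realType} {m : nat} (p : 'I_m -> R).
Context {dsp : measure_display} {Omega : measurableType dsp}.
Context (P : probability Omega R) (idx : nat -> Omega -> 'I_m).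
Hypothesis hidx : iid_indices P p idx.

Definition word (n : nat) (w : Omega) : seq 'I_m := mkseq (idx ^~ w) n.

Lemma size_word n w : size (word n w) = n.
Proof. exact: size_mkseq. Qed.

Lemma word_bigcap n (t : n.-tuple 'I_m) (i0 : 'I_m) :
  [set w | word n w = t] =
  \bigcap_(k in [set` iota 0 n]) (idx k @^-1` [set nth i0 t k]).
Proof.
apply/seteqP; split=> [w /= wt k|w H] /=.
  by rewrite mem_iota add0n => kn; rewrite -wt nth_mkseq.
apply: (@eq_from_nth _ i0); first by rewrite size_word size_tuple.
move=> k; rewrite size_word => kn; rewrite nth_mkseq//.
by apply: H; rewrite /= mem_iota.
Qed.

Lemma measurable_word n (t : n.-tuple 'I_m) : measurable [set w | word n w = t].
Proof.
have [mi _ _] := hidx.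
(* The empty word is treated apart: it provides no letter to serve as default for [nth], and its
   event is the whole space. *)
case: n t => [|n] t.
  rewrite (_ : [set w | _] = setT)//; apply/seteqP; split => // w _ /=.
  by rewrite tuple0.
rewrite (word_bigcap _ _ (tnth t ord0)).
apply: fin_bigcap_measurable; first exact: finite_seq.
by move=> k _; exact: mi.
Qed.

Lemma prob_word n (t : n.-tuple 'I_m) :
  P [set w | word n w = t] = (\prod_(i <- t) p i)%:E.
Proof.
have [_ pi ind] := hidx.
case: n t => [|n] t.
  rewrite (_ : [set w | _] = setT).
    by rewrite probability_setT tuple0 big_nil.
  by apply/seteqP; split => // w _ /=; rewrite tuple0.
rewrite (word_bigcap _ _ (tnth t ord0)) (ind _ (fun k => [set nth _ t k])) ?iota_uniq//.
rewrite (big_nth (tnth t ord0)) size_tuple /index_iota subn0.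
rewrite -prodEFin; apply: eq_bigr => k _; exact: pi.
Qed.

Lemma Rintegral_sum (I : Type) (r : seq I) (F : I -> Omega -> R) :
  (forall i, P.-integrable setT (EFin \o F i)) ->
  P.-integrable setT (EFin \o (fun w => \sum_(i <- r) F i w)) /\
  \int[P]_w (\sum_(i <- r) F i w) = \sum_(i <- r) \int[P]_w F i w.
Proof.
move=> iF; elim: r => [|i r [IH1 IH2]].
  under eq_Rintegral do rewrite big_nil.
  under eq_fun do rewrite big_nil.
  by rewrite big_nil Rintegral_const; split => //; exact: integrable_const.
under eq_Rintegral do rewrite big_cons.
under eq_fun do rewrite big_cons.
by split; [exact: integrable_add|rewrite RintegralD// IH2 big_cons].
Qed.

(** A function of the word is a finite combination of the indicators of the events on which the word
    is prescribed. *)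
Lemma Rintegral_word n (g : seq 'I_m -> R) :
  \int[P]_w g (word n w) = \sum_(t : n.-tuple 'I_m) (\prod_(i <- t) p i) * g t.
Proof.
have i1 (t : n.-tuple 'I_m) :
    P.-integrable setT (EFin \o (fun w => \1_[set w | word n w = t] w : R)).
  apply: integrable_dominated (integrable_const P 1) _.
    by apply: measurable_indic; exact: measurable_word.
  by move=> w; rewrite ger0_norm// indicE; case: (_ \in _).
have gE w : g (word n w) =
    \sum_(t : n.-tuple 'I_m) g t * \1_[set w | word n w = t] w.
  have sw : size (word n w) == n by rewrite size_word.
  rewrite (bigD1 (Tuple sw))//= indicE mem_set// mulr1 big1 ?addr0// => t.
  move=> /eqP tw; rewrite indicE memNset ?mulr0// => /= e.
  by apply: tw; apply: val_inj.
under eq_Rintegral do rewrite gE.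
have [_ ->] := Rintegral_sum (n.-tuple 'I_m) (index_enum _)
  (fun t w => g t * \1_[set w | word n w = t] w) (fun t => integrableZ P _ _ (i1 t)).
apply: eq_bigr => t _; rewrite RintegralZl// mulrC; congr (_ * _).
rewrite /Rintegral integral_indic//; last exact: measurable_word.
by rewrite setIT; exact: (congr1 fine (prob_word _ t)).
Qed.

Lemma sum_tuple_wexp n (g : seq 'I_m -> R) :
  \sum_(t : n.-tuple 'I_m) (\prod_(i <- t) p i) * g t = wexp p n g.
Proof.
elim: n g => [|n IH] g /=.
  rewrite (big_pred1 [tuple]) => [|t]; last by apply/esym/eqP; exact: tuple0.
  by rewrite big_nil mul1r.
rewrite (reindex (fun it : 'I_m * n.-tuple 'I_m => [tuple of it.1 :: it.2])) /=; last first.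
  apply: onW_bij; exists (fun t => (thead t, [tuple of behead t])) => [[i t]|t] /=.
    by rewrite theadE; congr pair; apply: val_inj.
  by rewrite [RHS]tuple_eta; apply: val_inj.
rewrite -(pair_big xpredT xpredT
  (fun i (t : n.-tuple 'I_m) => (\prod_(j <- i :: t) p j) * g (i :: t)))/=.
apply: eq_bigr => i _; rewrite -IH mulr_sumr.
by apply: eq_bigr => t _; rewrite big_cons mulrA.
Qed.

Lemma mean_word n (g : seq 'I_m -> R) :
  mean P (fun w => g (word n w)) = wexp p n g.
Proof. by rewrite meanE Rintegral_word sum_tuple_wexp. Qed.

End WordLaw.

(** * The central limit theorem for powers of the maximum *)

Section MomentConvergence.
Context {R : realType} {m s : nat} (p : 'I_m -> R) (y : 'I_m -> 'rV[R]_s).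
Hypotheses (hp0 : forall i, 0 <= p i) (hp1 : \sum_i p i = 1) (s0 : (0 < s)%N).
Hypothesis y_centered : forall a, \sum_i p i * dotv a (y i) = 0.
Context (Sigma : 'M[R]_s).
Hypothesis SigmaE : forall a, quadv Sigma a = \sum_i p i * dotv a (y i) ^+ 2.
Hypothesis Sigma_gt0 : forall a, a != 0 -> 0 < quadv Sigma a.
Context {dsp : measure_display} {Omega : measurableType dsp}.
Context (P : probability Omega R) (U : Omega -> 'rV[R]_s).
Hypothesis hU : centered_gaussian P Sigma U.

Definition scaled_sum (n : nat) (t : seq 'I_m) : 'rV[R]_s :=
  isqrt n *: \sum_(i <- t) y i.

Lemma dotv_scaled_sum a n t :
  dotv a (scaled_sum n t) = isqrt n * \sum_(i <- t) dotv a (y i).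
Proof.
rewrite dotvC dotvZl; congr (_ * _); elim: t => [|i t IH].
  by rewrite !big_nil /dotv big1// => k _; rewrite mxE mul0r.
by rewrite !big_cons dotvDl IH dotvC.
Qed.

(** The exponential of the l1 norm is dominated by finitely many exponentials of linear forms, each
    with a bounded moment generating function because the letters are centered. This is the uniform
    integrability behind the convergence of moments. *)
Lemma wexp_exp_normone_bounded : exists2 C, 0 < C & forall n, (0 < n)%N ->
  wexp p n (fun t => expR (normone (scaled_sum n t))) <= C.
Proof.
have H a : exists2 C, 0 < C & forall n, (0 < n)%N ->
    wexp p n (fun t => expR (dotv a (scaled_sum n t))) <= C.
  have [C C0 HC] := wexp_mgf_bounded _ hp0 hp1 _ (y_centered a).
  exists C => // n n0; apply: le_trans (HC n n0); apply: wexp_le => // t _.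
  by rewrite dotv_scaled_sum.
have [C C0 HC] : exists2 C : 'I_s -> R, (forall k, 0 < C k) &
    forall k n, (0 < n)%N ->
    wexp p n (fun t => expR (dotv (s%:R *: delta_mx 0 k) (scaled_sum n t)) +
                       expR (dotv (- s%:R *: delta_mx 0 k) (scaled_sum n t))) <= C k.
  have H2 k : exists C, 0 < C /\ forall n, (0 < n)%N ->
    wexp p n (fun t => expR (dotv (s%:R *: delta_mx 0 k) (scaled_sum n t)) +
                       expR (dotv (- s%:R *: delta_mx 0 k) (scaled_sum n t))) <= C.
    have [C1 C10 H1] := H (s%:R *: delta_mx 0 k).
    have [C2 C20 H2] := H (- s%:R *: delta_mx 0 k).
    exists (C1 + C2); split; first exact: addr_gt0.
    by move=> n n0; rewrite wexpD; apply: lerD; [exact: H1|exact: H2].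
  have [C HC] := choice H2; exists C => k; first by have [] := HC k.
  by move=> n n0; have [_] := HC k; apply.
exists (\sum_k C k) => [|n n0].
  by rewrite (bigD1 (Ordinal s0))//= ltr_pwDl// sumr_ge0// => k _; exact: ltW.
apply: (@le_trans _ _ (\sum_k wexp p n (fun t =>
     expR (dotv (s%:R *: delta_mx 0 k) (scaled_sum n t)) +
     expR (dotv (- s%:R *: delta_mx 0 k) (scaled_sum n t))))); last first.
  by apply: ler_sum => k _; exact: HC.
rewrite -wexp_sum; apply: wexp_le => // t _.
exact: expR_normone_le.
Qed.

Lemma measurable_dotvU a : measurable_fun setT (fun w => dotv a (U w)).
Proof.
apply: measurable_sum => k; apply: measurable_funM => //.
exact: hU.1.
Qed.

Let sd_gt0 a : a != 0 -> 0 < Num.sqrt (quadv Sigma a).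
Proof. by move=> a0; rewrite sqrtr_gt0 Sigma_gt0. Qed.

Lemma dotv0l (u : 'rV[R]_s) : dotv 0 u = 0.
Proof. by rewrite /dotv big1// => k _; rewrite mxE mul0r. Qed.

Lemma integrable_exp_dotvU a :
  P.-integrable setT (EFin \o (fun w => expR (dotv a (U w)))).
Proof.
have [->|a0] := eqVneq a 0.
  under eq_fun do rewrite dotv0l.
  exact: integrable_const.
have := integrable_gaussian_exp P _ _ (sd_gt0 _ a0) (measurable_dotvU a)
  (fun B => hU.2 a a0 B) 1.
by under eq_fun do rewrite mul1r.
Qed.

Lemma measurable_normoneU : measurable_fun setT (fun w => normone (U w)).
Proof.
apply: measurable_sum => k; apply: measurableT_comp => //.
exact: hU.1.
Qed.

Lemma integrable_exp_normoneU :
  P.-integrable setT (EFin \o (fun w => expR (normone (U w)))).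
Proof.
have i1 k : P.-integrable setT (EFin \o (fun w =>
    expR (dotv (s%:R *: delta_mx 0 k) (U w)) +
    expR (dotv (- s%:R *: delta_mx 0 k) (U w)))).
  by apply: integrable_add; exact: integrable_exp_dotvU.
have [i2 _] := Rintegral_sum P 'I_s (index_enum _) _ i1.
apply: integrable_dominated i2 _.
  by apply: measurableT_comp => //; exact: measurable_normoneU.
by move=> w; rewrite ger0_norm ?expR_ge0// expR_normone_le.
Qed.

Lemma measurable_vmaxU k : measurable_fun setT (fun w => vmax (U w) ^+ k).
Proof.
apply: measurable_funX.
rewrite (_ : (fun w => _) =
  fun w => \big[Num.max/U w 0 (Ordinal s0)]_j U w 0 j); last first.
  by apply/funext => w; rewrite /vmax (fmaxE _ (Ordinal s0)).
elim: (index_enum _) => [|j r IH].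
  under eq_fun do rewrite big_nil.
  exact: hU.1.
under eq_fun do rewrite big_cons.
by apply: measurable_maxr => //; exact: hU.1.
Qed.

Lemma integrable_vmaxU k :
  P.-integrable setT (EFin \o (fun w => vmax (U w) ^+ k)).
Proof.
apply: (integrable_dominated (measurable_vmaxU k)
  (integrableZ P k`!%:R _ integrable_exp_normoneU)) => w /=.
rewrite normrX (le_trans _ (normone_exp_le _ _))//.
by rewrite lerXn2r ?nnegrE// ?normone_ge0// norm_vmax_le.
Qed.

Lemma trigpoly_cvg h : trigpoly h ->
  P.-integrable setT (EFin \o (fun w => h (U w))) /\
  wexp p n (fun t => h (scaled_sum n t)) @[n --> \oo] --> \int[P]_w h (U w).
Proof.
elim=> [c t a|f g _ [if_ cf] _ [ig cg]]; last first.
  split; first exact: integrable_add.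
  rewrite RintegralD//; under eq_fun do rewrite wexpD.
  exact: cvgD.
have mc : measurable_fun setT (fun w => cos (t + dotv a (U w))).
  apply: measurableT_comp; first exact: continuous_measurable_fun (@continuous_cos R).
  by apply: measurable_funD => //; exact: measurable_dotvU.
have ic : P.-integrable setT (EFin \o (fun w => cos (t + dotv a (U w)))).
  apply: integrable_dominated mc (integrable_const P 1) _ => w.
  exact: cos_max.
split; first exact: integrableZ.
rewrite RintegralZl//; under eq_fun do rewrite wexpZ.
apply: cvgM; first exact: cvg_cst.
(* [centered_gaussian] prescribes the law of [dotv a U] for nonzero [a]; for [a = 0] both sides are
   the constant [cos t]. *)
have [->|a0] := eqVneq a 0.
  under eq_Rintegral do rewrite dotv0l addr0.
  rewrite Rintegral_const (_ : (fun n => _) = fun=> cos t); first exact: cvg_cst.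
  apply/funext => n; rewrite -[RHS](wexp_cst p hp1 n); congr wexp.
  by apply/funext => w; rewrite dotv0l addr0.
have := Rintegral_gaussian_cos P _ _ (sd_gt0 _ a0) (measurable_dotvU a)
  (fun B => hU.2 a a0 B) t 1.
under eq_Rintegral do rewrite mul1r.
move=> ->; rewrite expr1n mul1r sqr_sqrtr ?ltW ?Sigma_gt0// SigmaE -mulNr.
rewrite (_ : (fun n => _) =
  fun n => wexp p n (fun w => cos (t + isqrt n * \sum_(i <- w) dotv a (y i)))).
  exact: wexp_cos_cvg.
by apply/funext => n; congr wexp; apply/funext => w; rewrite dotv_scaled_sum.
Qed.

(** The power of the maximum is replaced by a trigonometric polynomial on both sides. The
    replacement costs [e1 * C] over words and [e1 * I] under the normal law, both uniform in [n];
    the polynomial itself converges by [trigpoly_cvg]. *)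
Lemma vmaxX_moment_cvg k :
  wexp p n (fun t => vmax (scaled_sum n t) ^+ k) @[n --> \oo] -->
  \int[P]_w vmax (U w) ^+ k.
Proof.
have [C C0 HC] := wexp_exp_normone_bounded.
have iN := integrable_exp_normoneU.
set I := \int[P]_w expR (normone (U w)).
have I0 : 0 <= I by apply: Rintegral_ge0 => w _; exact: expR_ge0.
apply/cvgrPdist_le => e e0.
pose e1 := e / 2 / (C + I + 1).
have CI0 : 0 < C + I + 1 by rewrite ltr_wpDl// addr_ge0// ltW.
have e10 : 0 < e1 by rewrite !divr_gt0.
have [h Hh happ] := vmaxX_trig_approx k e1 s0 e10.
have [ih ch] := trigpoly_cvg h Hh.
move/cvgrPdist_le : ch => /(_ _ (divr_gt0 e0 (ltr0n R 2))) ch.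
near=> n.
have n0 : (0 < n)%N by near: n; exact: nbhs_infty_gt.
have H1 : `|\int[P]_w vmax (U w) ^+ k - \int[P]_w h (U w)| <= e1 * I.
  rewrite -RintegralB//; last exact: integrable_vmaxU.
  have iD : P.-integrable setT (EFin \o (fun w => vmax (U w) ^+ k - h (U w))).
    rewrite (_ : (fun w => _) = fun w => vmax (U w) ^+ k + (-1) * h (U w)).
      by apply: integrable_add; [exact: integrable_vmaxU|exact: integrableZ].
    by apply/funext => w; rewrite mulN1r.
  rewrite (le_trans (le_normr_Rintegral _ iD))// -RintegralZl//.
  apply: le_Rintegral => //; last exact: integrableZ.
  rewrite (_ : _ \o _ = fun x => `|(EFin \o (fun w => (vmax (U w) ^+ k - h (U w))%R)) x|%E)//.
  exact: integrable_abse.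
have H2 : `|wexp p n (fun t => h (scaled_sum n t)) -
            wexp p n (fun t => vmax (scaled_sum n t) ^+ k)| <= e1 * C.
  rewrite distrC.
  rewrite (le_trans (wexp_dist_le _ hp0 n _ _
     (fun t => e1 * expR (normone (scaled_sum n t))) _))//.
  by rewrite wexpZ ler_wpM2l ?(ltW e10)// HC.
have H3 : `|\int[P]_w h (U w) - wexp p n (fun t => h (scaled_sum n t))| <= e / 2.
  by near: n.
have H4 := ler_distD (wexp p n (fun t => h (scaled_sum n t)))
  (\int[P]_w h (U w)) (wexp p n (fun t => vmax (scaled_sum n t) ^+ k)).
have H5 := ler_distD (\int[P]_w h (U w)) (\int[P]_w vmax (U w) ^+ k)
  (wexp p n (fun t => vmax (scaled_sum n t) ^+ k)).
have : e1 * (C + I + 1) = e / 2 by rewrite divfK// gt_eqF.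
rewrite !mulrDr mulr1.
lra.
Unshelve. all: by end_near. Qed.

End MomentConvergence.

(** * Spectral radius of triangular products *)

Section TriangularSpectralRadius.
Context {R : realType} {d : nat}.
Implicit Types A B : 'M[R[i]]_d.

Lemma trig_mulmx A B : is_trig_mx A -> is_trig_mx B ->
  is_trig_mx (A *m B) /\ forall j, (A *m B) j j = A j j * B j j.
Proof.
move=> /is_trig_mxP tA /is_trig_mxP tB; split=> [|j].
  apply/is_trig_mxP => i j ij; rewrite mxE big1// => k _.
  have [ik|ki] := ltnP i k; first by rewrite tA// mul0r.
  by rewrite tB ?mulr0// (leq_ltn_trans ki).
rewrite mxE (bigD1 j)//= big1 ?addr0// => k kj.
have [jk|] := ltnP j k; first by rewrite tA// mul0r.
by rewrite leq_eqVlt (negPf kj : (val k == val j) = false) => /= /tB ->; rewrite mulr0.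
Qed.

(** The characteristic polynomial splits over the diagonal, so the eigenvalues are exactly the
    diagonal entries. *)
Lemma spectral_radius_trig A : is_trig_mx A ->
  spectral_radius A = fmax (fun j => normc (A j j)).
Proof.
move=> tA; congr sup; apply/seteqP; split=> [_ [a /= Ha <-]|_ [j _ <-]].
  move: Ha; rewrite eigenvalue_root_char char_poly_trig// => Ha.
  suff [j ->] : exists j, a = A j j by exists j.
  move: Ha; rewrite rootE horner_prod => /prodf_eq0[j _].
  by rewrite hornerXsubC subr_eq0 => /eqP ->; exists j.
exists (A j j) => //=; rewrite eigenvalue_root_char char_poly_trig//.
by rewrite rootE horner_prod (bigD1 j)//= hornerXsubC subrr mul0r.
Qed.

(** A matrix and its transpose share their characteristic polynomial; this reduces upper triangular
    products to lower triangular ones. *)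
Lemma spectral_radius_tr A : spectral_radius A^T = spectral_radius A.
Proof.
have cE : char_poly A^T = char_poly A.
  rewrite /char_poly -[RHS]det_tr; congr (\det _).
  by apply/matrixP => i j; rewrite !mxE eq_sym.
have e : eigenvalue A^T = eigenvalue A.
  by apply/funext => a; rewrite !eigenvalue_root_char cE.
by rewrite /spectral_radius e.
Qed.

End TriangularSpectralRadius.

(** * A closed formula for the random spectral radius *)

Section RhoFormula.
Context {R : realType} {d m : nat} (T : 'I_m -> 'M[R[i]]_d).
Hypothesis hT : (forall i, is_trig_mx (T i)^T) \/ (forall i, is_trig_mx (T i)).
Hypothesis hdiag : forall i j, T i j j != 0.
Context (Omega : Type) (idx : nat -> Omega -> 'I_m).

Lemma trig_word_prod (S : 'I_m -> 'M[R[i]]_d) w n :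
  (forall i, is_trig_mx (S i)) -> is_trig_mx (word_prod S w n) /\
  forall j, word_prod S w n j j = \prod_(i <- mkseq w n) S i j j.
Proof.
move=> tS; elim: n => [|n [IH1 IH2]] /=.
  split; first exact: scalar_mx_is_trig.
  by move=> j; rewrite big_nil mxE eqxx.
have [t1 t2] := trig_mulmx _ _ (tS (w n)) IH1; split => // j.
by rewrite t2 IH2 mkseqS big_rcons mulrC.
Qed.

Lemma trig_word_prod_tr w n : (forall i, is_trig_mx (T i)^T) ->
  is_trig_mx (word_prod T w n)^T /\
  forall j, word_prod T w n j j = \prod_(i <- mkseq w n) T i j j.
Proof.
move=> tT; elim: n => [|n [IH1 IH2]] /=.
  split; first by rewrite tr_scalar_mx; exact: scalar_mx_is_trig.
  by move=> j; rewrite big_nil mxE eqxx.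
have [t1 t2] := trig_mulmx _ _ IH1 (tT (w n)); rewrite trmx_mul; split => // j.
have := t2 j; rewrite -trmx_mul !mxE => ->.
by rewrite IH2 mkseqS big_rcons.
Qed.

Lemma normc_gt0 (x : R[i]) : x != 0 -> 0 < normc x.
Proof.
move=> x0; rewrite lt_neqAle; apply/andP; split; last first.
  by case: x {x0} => a b /=; exact: sqrtr_ge0.
by apply: contra x0 => /eqP/esym/eq0_normc ->.
Qed.

Lemma expR_loglam i j : expR (loglam T i j) = normc (T i j j).
Proof. by rewrite lnK// posrE normc_gt0. Qed.

Lemma normc_prod_diag (t : seq 'I_m) j :
  normc (\prod_(i <- t) T i j j) = expR (\sum_(i <- t) loglam T i j).
Proof.
elim: t => [|i t IH].
  by rewrite !big_nil expR0 /= expr0n/= addr0 expr1n sqrtr1.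
by rewrite !big_cons normcM IH expRD expR_loglam.
Qed.

Lemma spectral_radius_word w n (j0 : 'I_d) :
  spectral_radius (word_prod T w n) =
  expR (fmax (fun j => \sum_(i <- mkseq w n) loglam T i j)).
Proof.
have -> : spectral_radius (word_prod T w n) =
    fmax (fun j => normc (\prod_(i <- mkseq w n) T i j j)).
  case: hT => tT.
    have [t1 t2] := trig_word_prod_tr w n tT.
    rewrite -spectral_radius_tr spectral_radius_trig//; congr fmax.
    by apply/funext => j; rewrite mxE t2.
  have [t1 t2] := trig_word_prod T w n tT.
  rewrite spectral_radius_trig//; congr fmax.
  by apply/funext => j; rewrite t2.
rewrite -(fmax_homo _ _ expR _ j0); last by move=> a b; rewrite ler_expR.
by congr fmax; apply/funext => j; rewrite normc_prod_diag.
Qed.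

Lemma rhoE n w (j0 : 'I_d) :
  rho T idx n w =
  expR (n%:R^-1 * fmax (fun j => \sum_(i <- mkseq (idx ^~ w) n) loglam T i j)).
Proof.
(* The spectral radius is an exponential, hence nonzero, so the real power takes its regular
   branch. *)
rewrite /rho spectral_radius_word// /powR expR_eq0.
by rewrite expRK.
Qed.

End RhoFormula.

(** * Expansions of the mean and of the variance *)

Section ExpansionAlgebra.
Context {R : realType}.

(** [R1] and [R2] stand for the first two moments of [rho_n / rho_infty]. With [P1], [P2] their
    truncated expansions, [P2 - P1 ^+ 2] is the announced main term minus [e ^+ 4 * Q], and
    replacing [R1], [R2] by [P1], [P2] costs order [e ^+ 4]. *)
Lemma variance_expansion (a1 a2 a3 A R1 R2 K1 K2 e : R) :
  1 <= A -> 0 <= e <= 1 -> 0 <= K1 -> 0 <= K2 ->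
  `|a1| <= A -> `|a2| <= A -> `|a3| <= A ->
  `|R1 - (1 + e * a1 + e ^+ 2 * a2 / 2 + e ^+ 3 * a3 / 6)| <= K1 * e ^+ 4 ->
  `|R2 - (1 + 2 * e * a1 + 2 * e ^+ 2 * a2 + 4 / 3 * e ^+ 3 * a3)| <= K2 * e ^+ 4 ->
  `|R2 - R1 ^+ 2 - e ^+ 2 * ((a2 - a1 ^+ 2) + e * (a3 - a1 * a2))| <=
  (K2 + 8 * A * K1 + K1 ^+ 2 + A ^+ 2) * e ^+ 4.
Proof.
move=> A1 /andP[e0 e1] K10 K20 ha1 ha2 ha3.
set P1 := 1 + e * a1 + _ + _; set P2 := 1 + 2 * e * a1 + _ + _ => h1 h2.
have A0 : 0 <= A by lra.
have en k : 0 <= e ^+ k <= 1 by rewrite exprn_ge0// exprn_ile1.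
have prod (x y : R) : `|x| <= A -> `|y| <= A -> `|x * y| <= A ^+ 2.
  by move=> xA yA; rewrite normrM expr2 ler_pM.
have small (x c : R) k : `|x| <= c -> 0 <= c -> `|e ^+ k * x| <= c.
  move=> xc c0; rewrite normrM ger0_norm; last by have /andP[] := en k.
  by rewrite -[leRHS]mul1r ler_pM//; have /andP[] := en k.
have P1A : `|P1| <= 4 * A.
  have := small a1 A 1 ha1 A0; have := small a2 A 2 ha2 A0; have := small a3 A 3 ha3 A0.
  rewrite /P1 expr1; set x1 := e * a1; set x2 := e ^+ 2 * a2; set x3 := e ^+ 3 * a3.
  rewrite !ler_norml => /andP[? ?] /andP[? ?] /andP[? ?]; apply/andP; split; lra.
(* The terms of degree at least 4 in [P1 ^+ 2], divided by [e ^+ 4]; their coefficients sum to less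
   than 1, so [A ^+ 2] bounds [Q]. *)
pose Q := a2 * a2 / 4 + a1 * a3 / 3 + e ^+ 1 * (a2 * a3) / 6 + e ^+ 2 * (a3 * a3) / 36.
have QA : `|Q| <= A ^+ 2.
  have A20 : 0 <= A ^+ 2 by rewrite sqr_ge0.
  have := prod _ _ ha2 ha2; have := prod _ _ ha1 ha3.
  have := small _ _ 1 (prod _ _ ha2 ha3) A20.
  have := small _ _ 2 (prod _ _ ha3 ha3) A20.
  rewrite /Q; move: A20.
  set q1 := a2 * a2; set q2 := a1 * a3; set q3 := e ^+ 1 * (a2 * a3).
  set q4 := e ^+ 2 * (a3 * a3); set B := A ^+ 2 => B0.
  rewrite !ler_norml => /andP[? ?] /andP[? ?] /andP[? ?] /andP[? ?].
  apply/andP; split; lra.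
have -> : R2 - R1 ^+ 2 - e ^+ 2 * ((a2 - a1 ^+ 2) + e * (a3 - a1 * a2)) =
  (R2 - P2) - 2 * P1 * (R1 - P1) - (R1 - P1) ^+ 2 - e ^+ 4 * Q.
  by rewrite /P1 /P2 /Q; field.
have e40 := en 4%N; have /andP[e4 e41] := e40.
have t1 : `|2 * P1 * (R1 - P1)| <= 8 * A * K1 * e ^+ 4.
  rewrite -mulrA [`|2 * _|]normrM ger0_norm// normrM.
  rewrite (_ : 8 * A * K1 * e ^+ 4 = 2 * ((4 * A) * (K1 * e ^+ 4))); last by ring.
  by rewrite ler_wpM2l// ler_pM.
have t2 : `|(R1 - P1) ^+ 2| <= K1 ^+ 2 * e ^+ 4.
  rewrite normrX (@le_trans _ _ ((K1 * e ^+ 4) ^+ 2))//.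
    by rewrite lerXn2r ?nnegrE// mulr_ge0.
  by rewrite exprMn ler_wpM2l ?sqr_ge0// expr2 ler_piMl.
have t3 : `|e ^+ 4 * Q| <= A ^+ 2 * e ^+ 4.
  by rewrite normrM (ger0_norm e4) mulrC ler_wpM2r.
have s1 := ler_normB ((R2 - P2) - 2 * P1 * (R1 - P1) - (R1 - P1) ^+ 2) (e ^+ 4 * Q).
have s2 := ler_normB ((R2 - P2) - 2 * P1 * (R1 - P1)) ((R1 - P1) ^+ 2).
have s3 := ler_normB (R2 - P2) (2 * P1 * (R1 - P1)).
rewrite [leRHS](_ : _ = K2 * e ^+ 4 + 8 * A * K1 * e ^+ 4 + K1 ^+ 2 * e ^+ 4 +
                        A ^+ 2 * e ^+ 4); last by ring.
rewrite (le_trans s1)// lerD// (le_trans s2)// lerD// (le_trans s3)// lerD//.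
Qed.

(** The common criterion for the four remainders, with [k] equal to 0, 1 or 2: a null sequence at
    the scale of [g], plus an error one order smaller. *)
Lemma littleo_isqrt (k : nat) (g e u : nat -> R) (K : R) :
  (forall n, g n = isqrt n ^+ k) ->
  (forall n, (0 < n)%N -> `|e n - isqrt n ^+ k * u n| <= K * isqrt n ^+ k.+1) ->
  u n @[n --> \oo] --> 0 -> e =o_\oo g.
Proof.
move=> gE eu u0; apply/eqoP => eps eps0.
have Kc : K * isqrt n @[n --> \oo] --> 0.
  by rewrite -(mulr0 K); apply: cvgM; [exact: cvg_cst|exact: cvg_isqrt].
move/cvgrPdist_le : u0 => /(_ _ (divr_gt0 eps0 (ltr0n R 2))) u0.
move/cvgrPdist_le : Kc => /(_ _ (divr_gt0 eps0 (ltr0n R 2))) Kc.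
near=> n.
have n0 : (0 < n)%N by near: n; exact: nbhs_infty_gt.
have h1 : `|0 - u n| <= eps / 2 by near: n.
have h2 : `|0 - K * isqrt n| <= eps / 2 by near: n.
rewrite !sub0r !normrN in h1 h2.
have ek0 : 0 <= isqrt n ^+ k :> R by rewrite exprn_ge0// isqrt_ge0.
rewrite gE (ger0_norm ek0).
have h3 := eu n n0.
have h4 := ler_normD (e n - isqrt n ^+ k * u n) (isqrt n ^+ k * u n).
rewrite subrK normrM (ger0_norm ek0) in h4.
rewrite (le_trans h4)// (splitr eps) mulrDl addrC lerD//.
  by rewrite mulrC ler_wpM2r.
rewrite (le_trans h3)// exprSr mulrA mulrAC ler_wpM2r//.
by rewrite (le_trans (ler_norm _)).
Unshelve. all: by end_near. Qed.

Lemma littleo_cvg (e : nat -> R) : e =o_\oo (fun n => (Num.sqrt n%:R)^-1) ->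
  (isqrt n)^-1 * e n @[n --> \oo] --> 0.
Proof.
move/eqoP => H; apply/cvgrPdist_le => eps eps0.
have := H _ eps0 => {}H; near=> n.
have n0 : (0 < n)%N by near: n; exact: nbhs_infty_gt.
have h : `|e n| <= eps * `|isqrt n| by near: n.
have i0 : 0 < isqrt n :> R by exact: isqrt_gt0.
have i1 : 0 < (isqrt n)^-1 :> R by rewrite invr_gt0.
rewrite sub0r normrN normrM (gtr0_norm i1) mulrC ler_pdivrMr//.
by rewrite (gtr0_norm i0) in h.
Unshelve. all: by end_near. Qed.

End ExpansionAlgebra.

(** * Centered logarithms of the diagonal entries and their covariance *)

Section LogDiagonal.
Context {R : realType} {d m : nat} (T : 'I_m -> 'M[R[i]]_d) (p : 'I_m -> R).
Hypotheses (hp0 : forall i, 0 <= p i) (hp1 : \sum_i p i = 1).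
Local Notation ll := (loglam T).
Local Notation mu := (mu T p).

Definition loglam_on (J : {set 'I_d}) (i : 'I_m) : 'rV[R]_#|J| :=
  \row_k (ll i (enum_val k) - mu (enum_val k)).

Lemma sum_centered j : \sum_i p i * (ll i j - mu j) = 0.
Proof.
under eq_bigr do rewrite mulrBr.
by rewrite sumrB -mulr_suml hp1 mul1r subrr.
Qed.

Lemma covlogE j k : covlog T p j k = \sum_i p i * ((ll i j - mu j) * (ll i k - mu k)).
Proof.
transitivity (\sum_i (p i * ll i j * ll i k - mu j * (p i * (ll i k - mu k)) -
                      mu k * (p i * ll i j))).
  rewrite !sumrB -!mulr_sumr sum_centered mulr0 subr0.
  by rewrite /covlog mulrC.
by apply: eq_bigr => i _; ring.
Qed.

Lemma loglam_on_centered J a : \sum_i p i * dotv a (loglam_on J i) = 0.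
Proof.
under eq_bigr do rewrite mulr_sumr.
rewrite exchange_big big1//= => k _.
under eq_bigr do rewrite mxE mulrCA.
by rewrite -mulr_sumr sum_centered mulr0.
Qed.

(** The quadratic form is the variance of the linear form [a] on one letter, which identifies the
    limit in the central limit theorem. *)
Lemma quadv_Sigma_on J a :
  quadv (Sigma_on T p J) a = \sum_i p i * dotv a (loglam_on J i) ^+ 2.
Proof.
transitivity (\sum_l \sum_k \sum_i
  p i * ((a 0 k * loglam_on J i 0 k) * (a 0 l * loglam_on J i 0 l))).
  apply: eq_bigr => l _; rewrite mxE mulr_suml; apply: eq_bigr => k _.
  rewrite mxE covlogE mulr_sumr mulr_suml; apply: eq_bigr => i _.
  by rewrite !mxE; ring.
under eq_bigr do rewrite exchange_big.
rewrite exchange_big; apply: eq_bigr => i _ /=.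
rewrite expr2 mulr_sumr mulr_sumr; apply: eq_bigr => l _.
by rewrite mulr_suml mulr_sumr.
Qed.

Lemma S_onE (Omega : Type) (idx : nat -> Omega -> 'I_m) J n w :
  S_on T p idx J n w = scaled_sum (loglam_on J) n (mkseq (idx ^~ w) n).
Proof.
rewrite /S_on /scaled_sum /mkseq big_map; congr (_ *: _).
rewrite -(big_mkord xpredT (fun k => Z_on T idx J k w - mu_on T p J)).
rewrite /index_iota subn0; apply: eq_bigr => k _.
by apply/rowP => l; rewrite !mxE.
Qed.

End LogDiagonal.

(** * Expansion of the exponential moments of the logarithmic ratio *)

Section RatioExpansion.
Context {R : realType} {d m : nat} (T : 'I_m -> 'M[R[i]]_d) (p : 'I_m -> R).
Hypotheses (hp0 : forall i, 0 <= p i) (hp1 : \sum_i p i = 1).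
Context (J : {set 'I_d}) (hJ : J = argmax_mu T p) (s0 : (0 < #|J|)%N).
Local Notation ll := (loglam T).
Local Notation mu := (mu T p).
Local Notation SS := (scaled_sum (loglam_on T p J)).

Let j0 : 'I_d := enum_val (Ordinal s0).

Let j0J : j0 \in J. Proof. exact: enum_valP. Qed.

Let mu_le j : mu j <= mu j0.
Proof. by have := j0J; rewrite hJ inE => /forallP. Qed.

Let mu_J j : j \in J -> mu j = mu j0.
Proof.
rewrite hJ inE => /forallP jm.
by apply/eqP; rewrite eq_le mu_le jm.
Qed.

Let mu_notJ j : j \notin J -> mu j < mu j0.
Proof.
move=> jJ; rewrite lt_neqAle mu_le andbT; apply: contra jJ => /eqP e.
by rewrite hJ inE; apply/forallP => h; rewrite e mu_le.
Qed.

Lemma rho_inftyE : rho_infty T p = expR (mu j0).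
Proof.
rewrite /rho_infty (fmax_homo _ _ expR mu j0); last by move=> a b; rewrite ler_expR.
congr expR; apply/eqP; rewrite eq_le le_fmax andbT.
by apply: (fmax_le _ j0).
Qed.

(* [log_ratio n t] is the logarithm of [rho_n / rho_infty] along the word [t]. *)
Definition log_ratio (n : nat) (t : seq 'I_m) : R :=
  fmax (fun j => n%:R^-1 * (\sum_(i <- t) ll i j) - mu j0).

Lemma rho_log_ratio (hT : (forall i, is_trig_mx (T i)^T) \/ (forall i, is_trig_mx (T i)))
  (hdiag : forall i j, T i j j != 0)
  (Omega : Type) (idx : nat -> Omega -> 'I_m) n w :
  rho T idx n w = rho_infty T p * expR (log_ratio n (mkseq (idx ^~ w) n)).
Proof.
rewrite (rhoE _ hT hdiag _ _ _ _ j0) rho_inftyE -expRD; congr expR.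
rewrite /log_ratio.
rewrite (fmax_homo _ _ (fun x => n%:R^-1 * x - mu j0)
          (fun j => \sum_(i <- mkseq (idx ^~ w) n) ll i j) j0).
  by rewrite addrC subrK.
by move=> a b ab; rewrite lerD2r ler_wpM2l// invr_ge0.
Qed.

(** The right-hand side is [log_ratio] with the maximum restricted to [J]. All coordinates in [J]
    have the mean [mu j0], so centering subtracts the same constant from each and commutes with the
    maximum. *)
Lemma vmax_scaled_sum n t : (0 < n)%N -> size t = n ->
  isqrt n * vmax (SS n t) =
  fmax (fun k : 'I_#|J| => n%:R^-1 * (\sum_(i <- t) ll i (enum_val k)) - mu j0).
Proof.
move=> n0 tn; rewrite /vmax.
rewrite -(fmax_homo _ _ (fun x => isqrt n * x) _ (Ordinal s0)); last first.
  by move=> a b ab; rewrite ler_wpM2l// isqrt_ge0.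
congr fmax; apply/funext => k.
rewrite !mxE mulrA -expr2 isqrt_sqr summxE.
under eq_bigr do rewrite mxE (mu_J _ (enum_valP k)).
rewrite sumrB mulrBr; congr (_ - _).
rewrite big_const_seq count_predT tn iter_addr_0 -[X in _ * X]mulr_natl mulrA mulVf ?mul1r//.
by rewrite pnatr_eq0 -lt0n.
Qed.

(** The centered increment of coordinate [j] relative to [j0]; its sum must be large for [j] outside
    [J] to overtake [j0]. *)
Let z j i : R := (ll i j - ll i j0) - (mu j - mu j0).

Let z_centered j : \sum_i p i * z j i = 0.
Proof.
transitivity (\sum_i (p i * (ll i j - mu j) - p i * (ll i j0 - mu j0))).
  by apply: eq_bigr => i _; rewrite /z; ring.
by rewrite sumrB !sum_centered// subrr.
Qed.

Let L : R := \sum_i \sum_j `|ll i j|.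
(** A bound on [log_ratio] valid for every word, as there are finitely many letters; it controls the
    exponentials even on exceptional words. *)
Let B : R := L + `|mu j0|.

Let llL i j : `|ll i j| <= L.
Proof.
rewrite /L (bigD1 i)//= (bigD1 j)//= -addrA lerDl addr_ge0 ?sumr_ge0// => k _.
exact: sumr_ge0.
Qed.

Let average_le n t j : (0 < n)%N -> size t = n ->
  `|n%:R^-1 * (\sum_(i <- t) ll i j) - mu j0| <= B.
Proof.
move=> n0 tn; rewrite (le_trans (ler_normB _ _))// lerD2r normrM ger0_norm ?invr_ge0//.
rewrite mulrC ler_pdivrMr ?ltr0n// (le_trans (ler_norm_sum _ _ _))//.
rewrite (le_trans (ler_sum _ (fun i _ => llL i j)))//.
by rewrite big_const_seq count_predT tn iter_addr_0 mulr_natr.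
Qed.

Let delta j := mu j0 - mu j.

(* Either some coordinate outside [J] overtakes [j0], which is exponentially
   unlikely, or the maximum is attained in [J] and Taylor's formula applies. *)
Let pointwise_expansion (q : nat) : exists2 K, 0 <= K &
  forall n t, (0 < n)%N -> size t = n ->
  `|expR (q%:R * log_ratio n t) -
    (1 + q%:R * (isqrt n * vmax (SS n t)) +
     (q%:R * (isqrt n * vmax (SS n t))) ^+ 2 / 2 +
     (q%:R * (isqrt n * vmax (SS n t))) ^+ 3 / 6)| <=
  K * isqrt n ^+ 4 *
  (expR (normone (SS n t)) + \sum_j expR (isqrt n * \sum_(i <- t) z j i)).
Proof.
pose E := expR (q%:R * B).
have E0 : 0 < E := expR_gt0 _.
(* For [j] in [J] the gap is 0 and the corresponding term is 0, by the convention on the inverse of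
   0. *)
pose D := \sum_j (delta j ^+ 4)^-1.
have D0 : 0 <= D.
  apply: sumr_ge0 => j _; rewrite invr_ge0 exprn_ge0// subr_ge0//.
exists (24%:R * E * (q%:R ^+ 4 + 2 * D)).
  rewrite !mulr_ge0 ?(ltW E0)// addr_ge0 ?exprn_ge0// mulr_ge0//.
move=> n t n0 tn; set e := isqrt n; set X := vmax _; set W := log_ratio n t.
have e0 : 0 < e by exact: isqrt_gt0.
have Xfmax := vmax_scaled_sum n t n0 tn; rewrite -/e -/X in Xfmax.
have WB : `|W| <= B.
  rewrite /W /log_ratio; have [j -> _] := fmax_attained
    (fun j => n%:R^-1 * (\sum_(i <- t) ll i j) - mu j0) j0.
  exact: average_le.
have XB : `|e * X| <= B.
  rewrite Xfmax; have [k -> _] := fmax_attained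
    (fun k : 'I_#|J| => n%:R^-1 * (\sum_(i <- t) ll i (enum_val k)) - mu j0) (Ordinal s0).
  exact: average_le.
set N := expR (normone _); have N0 : 0 < N := expR_gt0 _.
pose Zs j := expR (e * \sum_(i <- t) z j i).
have Zs0 j : 0 < Zs j := expR_gt0 _.
have ZS0 : 0 <= \sum_j Zs j by apply: sumr_ge0 => j _; exact: ltW.
have q0 : (0 : R) <= q%:R by [].
have q4 : (0 : R) <= q%:R ^+ 4 by rewrite exprn_ge0.
have e4 : 0 <= e ^+ 4 by rewrite exprn_ge0// ltW.
have taylor : `|expR (q%:R * (e * X)) - (1 + q%:R * (e * X) +
     (q%:R * (e * X)) ^+ 2 / 2 + (q%:R * (e * X)) ^+ 3 / 6)| <=
     24%:R * E * q%:R ^+ 4 * e ^+ 4 * N.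
  have qXB : `|q%:R * (e * X)| <= q%:R * B.
    by rewrite normrM ger0_norm// ler_wpM2l.
  rewrite (le_trans (expR_taylor4 _ _ qXB))// -/E.
  rewrite !normrM !exprMn (ger0_norm q0) (gtr0_norm e0).
  rewrite (_ : 24%:R * E * q%:R ^+ 4 * e ^+ 4 * N =
               E * (q%:R ^+ 4 * (e ^+ 4 * (24%:R * N)))); last by ring.
  rewrite ler_wpM2l ?(ltW E0)// ler_wpM2l// ler_wpM2l//.
  rewrite (@le_trans _ _ (normone (SS n t) ^+ 4))//; last exact: (normone_exp_le _ 4).
  by rewrite lerXn2r ?nnegrE ?normone_ge0// norm_vmax_le.
have XW : e * X <= W.
  rewrite Xfmax; apply: (fmax_le _ (Ordinal s0)) => k.
  exact: (le_fmax (fun j => n%:R^-1 * (\sum_(i <- t) ll i j) - mu j0)).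
have first_part : `|expR (q%:R * W) - expR (q%:R * (e * X))| <=
    24%:R * E * (2 * D) * e ^+ 4 * \sum_j Zs j.
  have [j Wj jmax] := fmax_attained
    (fun j => n%:R^-1 * (\sum_(i <- t) ll i j) - mu j0) j0.
  have [jJ|jJ] := boolP (j \in J).
    have -> : W = e * X.
      apply/eqP; rewrite eq_le XW andbT /W /log_ratio Wj Xfmax.
      rewrite -[in leLHS](enum_rankK_in jJ jJ).
      exact: (le_fmax (fun k : 'I_#|J| =>
        n%:R^-1 * (\sum_(i <- t) ll i (enum_val k)) - mu j0)).
    have c0 : 0 <= 24%:R * E * (2 * D) by rewrite !mulr_ge0// ltW.
    by rewrite subrr normr0 mulr_ge0// mulr_ge0.
  have dj : 0 < delta j by rewrite subr_gt0 mu_notJ.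
  pose x := e * \sum_(i <- t) z j i.
  (* As [j] attains the maximum, its average is at least that of [j0], so the centered difference
     makes up at least the gap. *)
  have ex : delta j <= e * x.
    rewrite /x mulrA -expr2 isqrt_sqr /z sumrB sumrB mulrBr.
    rewrite (_ : n%:R^-1 * (\sum_(i <- t) (mu j - mu j0)) = - delta j); last first.
      rewrite big_const_seq count_predT tn iter_addr_0 -[X in _ * X]mulr_natl mulrA mulVf.
        by rewrite mul1r opprB.
      by rewrite pnatr_eq0 -lt0n.
    rewrite opprK lerDr mulrBr subr_ge0.
    by have := jmax j0; rewrite lerD2r.
  have x0 : 0 < x by rewrite -(pmulr_rgt0 _ e0) (lt_le_trans dj).
  (* A Markov-type bound: the fourth power of [delta j <= e * x], combined with
     [x ^+ 4 <= 24 * expR x], provides the factor [e ^+ 4]. *)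
  have one : 1 <= 24%:R * D * e ^+ 4 * \sum_j Zs j.
    have one1 : 1 <= (delta j ^+ 4)^-1 * (e ^+ 4 * (24%:R * Zs j)).
      rewrite mulrC ler_pdivlMr ?exprn_gt0// mul1r.
      rewrite (@le_trans _ _ ((e * x) ^+ 4))//.
        by rewrite lerXn2r ?nnegrE ?(ltW dj)// mulr_ge0// ltW.
      by rewrite exprMn ler_wpM2l// (exprn_le_expR x 4)// ltW.
    apply: (le_trans one1).
    rewrite (_ : 24%:R * D * e ^+ 4 * _ = D * (e ^+ 4 * (24%:R * \sum_j Zs j))); last by ring.
    apply: ler_pM.
    - by rewrite invr_ge0 exprn_ge0// ltW.
    - by rewrite !mulr_ge0// ltW.
    - rewrite /D (bigD1 j)//= lerDl; apply: sumr_ge0 => k _.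
      by rewrite invr_ge0 exprn_ge0// subr_ge0.
    - rewrite ler_wpM2l// ler_wpM2l// (bigD1 j)//= lerDl.
      by apply: sumr_ge0 => k _; exact: ltW.
  have bE x' : `|x'| <= B -> `|expR (q%:R * x')| <= E.
    move=> xB; rewrite ger0_norm ?expR_ge0// ler_expR ler_wpM2l//.
    by rewrite (le_trans (ler_norm _)).
  (* On exceptional words each exponential is merely bounded by [E]; the smallness comes from
     [one]. *)
  rewrite (le_trans (ler_normB _ _))//.
  rewrite (@le_trans _ _ (E + E))//; first by rewrite lerD// bE.
  rewrite (_ : 24%:R * E * (2 * D) * e ^+ 4 * _ =
    (E + E) * (24%:R * D * e ^+ 4 * \sum_j Zs j)); last by ring.
  by rewrite ler_peMr// addr_ge0// ltW.
rewrite -(subrKA (expR (q%:R * (e * X)))) (le_trans (ler_normD _ _))//.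
rewrite (le_trans (lerD first_part taylor))//.
rewrite -subr_ge0 (_ : _ - _ = 24%:R * E * e ^+ 4 *
  (q%:R ^+ 4 * (\sum_j Zs j) + 2 * D * N)); last by rewrite /Zs; ring.
apply: mulr_ge0; first by rewrite !mulr_ge0// ltW.
by rewrite addr_ge0// !mulr_ge0// ltW.
Qed.

(** The pointwise error is [isqrt n ^+ 4] times exponentials whose expectations are bounded
    uniformly in [n]. The cases [q = 1] and [q = 2] give the first and second moments of
    [rho_n / rho_infty]. *)
Lemma wexp_ratio_expansion (q : nat) : exists2 K, 0 <= K & forall n, (0 < n)%N ->
  `|wexp p n (fun t => expR (q%:R * log_ratio n t)) -
    (1 + q%:R * isqrt n * wexp p n (fun t => vmax (SS n t) ^+ 1) +
     q%:R ^+ 2 / 2 * isqrt n ^+ 2 * wexp p n (fun t => vmax (SS n t) ^+ 2) +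
     q%:R ^+ 3 / 6 * isqrt n ^+ 3 * wexp p n (fun t => vmax (SS n t) ^+ 3))| <=
  K * isqrt n ^+ 4.
Proof.
have [K K0 HK] := pointwise_expansion q.
have [C C0 HC] := wexp_exp_normone_bounded p _ hp0 hp1 s0 (loglam_on_centered T p hp1 J).
have HZ j : exists c, 0 < c /\ forall n, (0 < n)%N ->
    wexp p n (fun t => expR (isqrt n * \sum_(i <- t) z j i)) <= c.
  by have [c c0 Hc] := wexp_mgf_bounded p hp0 hp1 _ (z_centered j); exists c.
have [C' HC'] := choice HZ.
exists (K * (C + \sum_j C' j)).
  rewrite mulr_ge0// addr_ge0 ?(ltW C0)// sumr_ge0// => j _.
  by have [/ltW] := HC' j.
move=> n n0.
have -> : 1 + q%:R * isqrt n * wexp p n (fun t => vmax (SS n t) ^+ 1) +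
     q%:R ^+ 2 / 2 * isqrt n ^+ 2 * wexp p n (fun t => vmax (SS n t) ^+ 2) +
     q%:R ^+ 3 / 6 * isqrt n ^+ 3 * wexp p n (fun t => vmax (SS n t) ^+ 3) =
  wexp p n (fun t => 1 + q%:R * (isqrt n * vmax (SS n t)) +
     (q%:R * (isqrt n * vmax (SS n t))) ^+ 2 / 2 +
     (q%:R * (isqrt n * vmax (SS n t))) ^+ 3 / 6).
  rewrite -!wexpZ -{1}(wexp_cst p hp1 n 1) -!wexpD; congr wexp.
  by apply/funext => t; rewrite !exprMn expr1; ring.
rewrite (le_trans (wexp_dist_le _ hp0 _ _ _ _ (fun t => HK n t n0)))//.
rewrite wexpZ mulrAC ler_wpM2r ?exprn_ge0 ?isqrt_ge0//.
rewrite ler_wpM2l// wexpD wexp_sum lerD ?HC//.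
by apply: ler_sum => j _; have [_] := HC' j; apply.
Qed.

End RatioExpansion.

(** * From bounds at fixed length to asymptotic expansions *)

Section Asymptotics.
Context {R : realType} (a1 a2 a3 R1 R2 : nat -> R) (m1 m2 m3 A K1 K2 : R).
Hypotheses (A1 : 1 <= A) (K10 : 0 <= K1) (K20 : 0 <= K2).
Hypothesis (a1A : forall n, (0 < n)%N -> `|a1 n| <= A).
Hypothesis (a2A : forall n, (0 < n)%N -> `|a2 n| <= A).
Hypothesis (a3A : forall n, (0 < n)%N -> `|a3 n| <= A).
Hypothesis (a1m : a1 n @[n --> \oo] --> m1).
Hypothesis (a2m : a2 n @[n --> \oo] --> m2).
Hypothesis (a3m : a3 n @[n --> \oo] --> m3).
Hypothesis R1E : forall n, (0 < n)%N ->
  `|R1 n - (1 + isqrt n * a1 n + isqrt n ^+ 2 * a2 n / 2 + isqrt n ^+ 3 * a3 n / 6)|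
  <= K1 * isqrt n ^+ 4.
Hypothesis R2E : forall n, (0 < n)%N ->
  `|R2 n - (1 + 2 * isqrt n * a1 n + 2 * isqrt n ^+ 2 * a2 n +
            4 / 3 * isqrt n ^+ 3 * a3 n)|
  <= K2 * isqrt n ^+ 4.

Let i0 n : 0 <= isqrt n :> R := isqrt_ge0 n.
Let i1 n : isqrt n <= 1 :> R := isqrt_le1 n.

Lemma mean_littleo :
  (fun n => R1 n - (1 + m1 / Num.sqrt n%:R)) =o_\oo (fun n => (Num.sqrt n%:R)^-1).
Proof.
apply: (@littleo_isqrt _ 1 _ _ (fun n => a1 n - m1) (2 * A + K1)) => [n|n n0|].
- by rewrite expr1.
- have r := R1E n n0.
  have b2 := a2A n n0; have b3 := a3A n n0.
  rewrite -/(isqrt n); have := i0 n; have := i1 n.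
  set e := isqrt n in r *; set x2 := a2 n in r b2 *; set x3 := a3 n in r b3 *.
  move=> e1 e0.
  have E2 : 0 <= e ^+ 2 by rewrite exprn_ge0.
  rewrite (_ : _ - e ^+ 1 * _ = (R1 n - (1 + e * a1 n + e ^+ 2 * x2 / 2 + e ^+ 3 * x3 / 6))
     + e ^+ 2 * (x2 / 2 + e * x3 / 6)); last by rewrite /e /isqrt; ring.
  rewrite (le_trans (ler_normD _ _))// mulrDl addrC lerD//.
    rewrite normrM (ger0_norm E2) mulrC ler_wpM2r//.
    have : `|e * x3| <= A by rewrite normrM (ger0_norm e0) -[leRHS]mul1r ler_pM.
    move: b2; move: (e * x3) => y; rewrite !ler_norml => /andP[? ?] /andP[? ?].
    by apply/andP; split; lra.
  rewrite (le_trans r)// ler_wpM2l//.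
  by rewrite -[leRHS]mulr1 (exprD e 2 2) ler_wpM2l// exprn_ile1.
- by rewrite -(subrr m1); apply: cvgB => //; exact: cvg_cst.
Qed.

Let K := K2 + 8 * A * K1 + K1 ^+ 2 + A ^+ 2.

Let K0 : 0 <= K.
Proof.
have A0 : 0 <= A by rewrite (le_trans _ A1).
by rewrite /K !addr_ge0// ?sqr_ge0// !mulr_ge0.
Qed.

Let var_bound n : (0 < n)%N ->
  `|n%:R * (R2 n - R1 n ^+ 2) - ((a2 n - a1 n ^+ 2) + isqrt n * (a3 n - a1 n * a2 n))|
  <= K * isqrt n ^+ 2.
Proof.
move=> n0; have nR : (0 : R) < n%:R by rewrite ltr0n.
have i01 : 0 <= (isqrt n : R) <= 1 by rewrite i0 i1.
have := variance_expansion _ _ _ _ _ _ _ _ _ A1 i01 K10 K20 (a1A n n0) (a2A n n0)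
  (a3A n n0) (R1E n n0) (R2E n n0).
have e2 : isqrt n ^+ 2 = n%:R^-1 :> R := isqrt_sqr n.
rewrite -/K (exprD _ 2 2) e2 => H.
rewrite -(ler_pM2l (_ : 0 < n%:R^-1)) ?invr_gt0//.
rewrite -[X in X * `|_|](@ger0_norm _ n%:R^-1) ?invr_ge0// -normrM mulrBr mulKf ?gt_eqF//.
by rewrite mulrCA.
Qed.

Lemma var_littleo :
  (fun n => n%:R * (R2 n - R1 n ^+ 2) - (m2 - m1 ^+ 2)) =o_\oo (fun=> 1 : R).
Proof.
apply: (@littleo_isqrt _ 0 _ _ (fun n => (a2 n - a1 n ^+ 2) - (m2 - m1 ^+ 2))
  (K + A + A ^+ 2)) => [n|n n0|]; first by rewrite expr0.
- have r := var_bound n n0.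
  have b1 := a1A n n0; have b2 := a2A n n0; have b3 := a3A n n0.
  rewrite expr0 mul1r expr1.
  rewrite (_ : _ - _ - _ = (n%:R * (R2 n - R1 n ^+ 2) - ((a2 n - a1 n ^+ 2) +
     isqrt n * (a3 n - a1 n * a2 n))) + (isqrt n * (a3 n - a1 n * a2 n))); last by ring.
  rewrite (le_trans (ler_normD _ _))// -[in leRHS]addrA [leRHS]mulrDl lerD//.
    rewrite (le_trans r)// ler_wpM2l// expr2 -[leRHS]mulr1 ler_wpM2l//.
  rewrite normrM (ger0_norm (i0 n)) mulrC ler_wpM2r//.
  rewrite (le_trans (ler_normB _ _))// lerD// normrM expr2 ler_pM//.
- rewrite -(subrr (m2 - m1 ^+ 2)); apply: cvgB; last exact: cvg_cst.
  by apply: cvgB => //; apply: cvgM.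
Qed.

Context (h r : R) (g1 g2 : nat -> R).
Hypothesis g1E : forall n, (0 < n)%N -> a1 n = m1 + isqrt n * h + isqrt n * g1 n.
Hypothesis g2E : forall n, (0 < n)%N -> a2 n = m2 + isqrt n * r + isqrt n * g2 n.
Hypothesis g10 : g1 n @[n --> \oo] --> 0.
Hypothesis g20 : g2 n @[n --> \oo] --> 0.

Lemma mean_littleo2 :
  (fun n => R1 n - (1 + m1 / Num.sqrt n%:R + n%:R^-1 * (m2 / 2 + h)))
  =o_\oo (fun n => n%:R^-1 : R).
Proof.
apply: (@littleo_isqrt _ 2 _ _ (fun n => g1 n + (a2 n - m2) / 2) (A + K1)) => [n|n n0|].
- by rewrite isqrt_sqr.
- have Rn := R1E n n0; have b3 := a3A n n0.
  rewrite -/(isqrt n) -isqrt_sqr; have := i0 n; have := i1 n; have e1 := g1E n n0.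
  set e := isqrt n in Rn e1 *; set x3 := a3 n in Rn b3 *.
  move=> el e0.
  have E3 : 0 <= e ^+ 3 by rewrite exprn_ge0.
  rewrite (_ : _ - e ^+ 2 * _ =
    (R1 n - (1 + e * a1 n + e ^+ 2 * a2 n / 2 + e ^+ 3 * x3 / 6)) + e ^+ 3 * (x3 / 6)).
    rewrite (le_trans (ler_normD _ _))// mulrDl addrC lerD//.
      rewrite normrM (ger0_norm E3) mulrC ler_wpM2r//.
      move: b3; rewrite !ler_norml => /andP[? ?].
      by apply/andP; split; lra.
    by rewrite (le_trans Rn)// ler_wpM2l// exprSr ler_piMr.
  by rewrite e1; field.
- rewrite -[X in _ --> X](_ : 0 + (m2 - m2) / 2 = 0); last by rewrite subrr mul0r addr0.
  apply: cvgD => //; apply: cvgM; last exact: cvg_cst.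
  by apply: cvgB => //; exact: cvg_cst.
Qed.

Lemma var_littleo2 :
  (fun n => n%:R * (R2 n - R1 n ^+ 2) - (m2 - m1 ^+ 2 +
     (Num.sqrt n%:R)^-1 * ((m3 - m1 * m2) + (r - 2 * m1 * h))))
  =o_\oo (fun n => (Num.sqrt n%:R)^-1).
Proof.
apply: (@littleo_isqrt _ 1 _ _ (fun n => g2 n - ((h + g1 n) * (a1 n + m1) - 2 * m1 * h)
   + (a3 n - a1 n * a2 n - (m3 - m1 * m2))) K) => [n|n n0|].
- by rewrite expr1.
- have := var_bound n n0; congr (`|_| <= _).
  rewrite -/(isqrt n) expr1.
  have e1 := g1E n n0; have e2 := g2E n n0.
  (* A difference of squares; [(h + g1 n) * (a1 n + m1)] tends to [2 * m1 * h], the correction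
     subtracted in the variance. *)
  have sq : a1 n ^+ 2 = m1 ^+ 2 + isqrt n * (h + g1 n) * (a1 n + m1).
    by rewrite e1; ring.
  by rewrite {1}e2 sq; ring.
- rewrite -[X in _ --> X](_ : 0 - ((h + 0) * (m1 + m1) - 2 * m1 * h) +
     (m3 - m1 * m2 - (m3 - m1 * m2)) = 0); last by ring.
  apply: cvgD.
    apply: cvgB => //; apply: cvgB; last exact: cvg_cst.
    apply: cvgM; apply: cvgD => //; exact: cvg_cst.
  apply: cvgB; last exact: cvg_cst.
  by apply: cvgB => //; apply: cvgM.
Qed.

End Asymptotics.

(** * Variance over words, and assembly of the expansions *)

Lemma variance_word {R : realType} {m : nat} (p : 'I_m -> R)
    (hp1 : \sum_i p i = 1)
    {dsp : measure_display} {Omega : measurableType dsp} (P : probability Omega R)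
    (idx : nat -> Omega -> 'I_m) (hidx : iid_indices P p idx) n (g : seq 'I_m -> R) :
  fine ('V_P[fun w => g (word idx n w)])%E =
  wexp p n (fun t => g t ^+ 2) - wexp p n g ^+ 2.
Proof.
rewrite /variance unlock -/(mean P (fun w => g (word idx n w))) (mean_word _ _ _ hidx).
set c := wexp p n g.
have := mean_word p P idx hidx n (fun t => g t ^+ 2 + (- 2 * c * g t + c ^+ 2)).
rewrite !wexpD wexpZ wexp_cst// -/c => H.
transitivity (mean P (fun w => g (word idx n w) ^+ 2 +
                                (- 2 * c * g (word idx n w) + c ^+ 2))).
  congr (fine (expectation _ _)); apply/funext => w /=; rewrite !fctE/=; ring.
by rewrite H; ring.
Qed.

Lemma sum3_linear {R : realType} {s : nat} (F G : ('I_s -> nat) -> R) c :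
  sum3 (fun a => F a - c * G a) = sum3 F - c * sum3 G.
Proof. by rewrite /sum3 sumrB mulr_sumr. Qed.

Theorem theorem6 (R : realType) (d m : nat)
  (T : 'I_m -> 'M[R[i]]_d)
  (hT : (forall i, is_trig_mx (T i)^T) \/ (forall i, is_trig_mx (T i)))
  (hdiag : forall i j, T i j j != 0)
  (p : 'I_m -> R) (hp0 : forall i, 0 <= p i) (hp1 : \sum_i p i = 1)
  (J : {set 'I_d}) (hJ : J = argmax_mu T p) (hs : (1 < #|J|)%N)
  (hSigma : posdefmx (Sigma_on T p J))
  (dsp : measure_display) (Omega : measurableType dsp) (P : probability Omega R)
  (idx : nat -> Omega -> 'I_m) (hidx : iid_indices P p idx)
  (dsp' : measure_display) (Omega' : measurableType dsp')
  (P' : probability Omega' R) (U : Omega' -> 'rV[R]_#|J|)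
  (hU : centered_gaussian P' (Sigma_on T p J) U) :
  let M := @vmax R #|J| in
  let mom k := mean P' (fun w => M (U w) ^+ k) in
  let v0 := mom 2%N - mom 1%N ^+ 2 in
  let v1 := mom 3%N - mom 1%N * mom 2%N in
  let Erho n := mean P (rho T idx n) in
  let Vrho n := fine ('V_P[rho T idx n])%E in
  let rinf := rho_infty T p in
  let coef (alpha : 'I_#|J| -> nat) := cumulant T p P idx alpha / (mfact alpha)%:R in
  let h alpha :=
    mean P' (fun w => M (U w) * hermite (Sigma_on T p J) alpha (U w)) in
  let r alpha :=
    mean P' (fun w => M (U w) ^+ 2 * hermite (Sigma_on T p J) alpha (U w)) in
  ((exists2 e : nat -> R, e =o_\oo (fun n => (Num.sqrt n%:R)^-1) &
      forall n, (0 < n)%N ->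
        Erho n = rinf * (1 + mom 1%N / Num.sqrt n%:R + e n)) /\
   (exists2 e : nat -> R, e =o_\oo (fun=> 1 : R) &
      forall n, (0 < n)%N -> n%:R * Vrho n = rinf ^+ 2 * (v0 + e n))) /\
  (edgeworth T p P idx P' U M ->
   edgeworth T p P idx P' U (fun u => M u ^+ 2) ->
   (exists2 e : nat -> R, e =o_\oo (fun n => n%:R^-1 : R) &
      forall n, (0 < n)%N ->
        Erho n = rinf * (1 + mom 1%N / Num.sqrt n%:R +
          n%:R^-1 * (mom 2%N / 2 + sum3 (fun alpha => coef alpha * h alpha)) +
          e n)) /\
   (exists2 e : nat -> R, e =o_\oo (fun n => (Num.sqrt n%:R)^-1) &
      forall n, (0 < n)%N ->
        n%:R * Vrho n = rinf ^+ 2 * (v0 +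
          (Num.sqrt n%:R)^-1 *
            (v1 + sum3 (fun alpha =>
                    coef alpha * (r alpha - 2 * mom 1%N * h alpha))) +
          e n))).
Proof.
move=> M mom v0 v1 Erho Vrho rinf coef h r.
have s0 : (0 < #|J|)%N := ltnW hs.
pose y := loglam_on T p J.
(* [a k n] is the moment of order [k] of the maximum of [S_n]; [R1] and [R2] are the first two
   moments of [rho_n / rho_infty]. *)
pose a k n := wexp p n (fun t => vmax (scaled_sum y n t) ^+ k).
pose R1 n := wexp p n (fun t => expR (log_ratio T p J s0 n t)).
pose R2 n := wexp p n (fun t => expR (2 * log_ratio T p J s0 n t)).
have yc := loglam_on_centered T p hp1 J.
have yS := quadv_Sigma_on T p hp1 J.
have am k : a k n @[n --> \oo] --> mom k.
  rewrite /mom meanE; exact: (vmaxX_moment_cvg p y hp0 hp1 s0 yc _ yS hSigma.2 P' U hU).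
have SE n w : S_on T p idx J n w = scaled_sum y n (word idx n w) := S_onE T p Omega idx J n w.
have ESE (f : 'rV[R]_#|J| -> R) n : mean P (f \o S_on T p idx J n) =
    wexp p n (fun t => f (scaled_sum y n t)).
  rewrite -(mean_word p P idx hidx); congr mean; apply/funext => w /=.
  by rewrite SE.
have ErhoE n : Erho n = rinf * R1 n.
  rewrite /Erho -wexpZ -(mean_word p P idx hidx); congr mean; apply/funext => w.
  exact: rho_log_ratio.
have VrhoE n : Vrho n = rinf ^+ 2 * (R2 n - R1 n ^+ 2).
  rewrite /Vrho (_ : rho T idx n = fun w => rinf * expR (log_ratio T p J s0 n (word idx n w))).
    rewrite (variance_word p hp1 P idx hidx n (fun t => rinf * expR (log_ratio T p J s0 n t))).
    rewrite wexpZ exprMn mulrBr; congr (_ - _).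
    rewrite /R2 -wexpZ; congr wexp; apply/funext => t.
    by rewrite exprMn -expRM_natl.
  by apply/funext => w; exact: rho_log_ratio.
have [C C0 HC] := wexp_exp_normone_bounded p y hp0 hp1 s0 yc.
(* The factor 6 bounds [k!] for [k <= 3], and the summand 1 gives [1 <= A]. *)
pose A := 1 + 6 * C.
have A1 : 1 <= A by rewrite lerDl mulr_ge0// ltW.
have aA k n : (k <= 3)%N -> (0 < n)%N -> `|a k n| <= A.
  move=> k3 n0.
  have -> : a k n = a k n - wexp p n (fun=> 0) by rewrite wexp_cst// subr0.
  rewrite (le_trans (wexp_dist_le p hp0 n _ _
    (fun t => 6 * expR (normone (scaled_sum y n t))) _))//.
    move=> t _; rewrite subr0 normrX.
    rewrite (@le_trans _ _ (normone (scaled_sum y n t) ^+ k))//.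
      by rewrite lerXn2r ?nnegrE ?normone_ge0// norm_vmax_le.
    rewrite (le_trans (normone_exp_le _ k))// ler_wpM2r ?expR_ge0// ler_nat.
    by move: k k3 => [|[|[|[|]]]].
  by rewrite wexpZ /A -[leLHS]add0r lerD// ler_wpM2l// HC.
have [K1 K10 H1] := wexp_ratio_expansion T p hp0 hp1 J hJ s0 1.
have [K2 K20 H2] := wexp_ratio_expansion T p hp0 hp1 J hJ s0 2.
have R1E n : (0 < n)%N -> `|R1 n - (1 + isqrt n * a 1%N n + isqrt n ^+ 2 * a 2%N n / 2 +
    isqrt n ^+ 3 * a 3%N n / 6)| <= K1 * isqrt n ^+ 4.
  move=> n0; apply: le_trans (H1 n n0); rewrite le_eqVlt; apply/orP; left; apply/eqP.
  congr (`|_ - _|); last by rewrite /a /y !expr1n; ring.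
  by congr wexp; apply/funext => t; rewrite mul1r.
have R2E n : (0 < n)%N -> `|R2 n - (1 + 2 * isqrt n * a 1%N n +
    2 * isqrt n ^+ 2 * a 2%N n + 4 / 3 * isqrt n ^+ 3 * a 3%N n)| <= K2 * isqrt n ^+ 4.
  move=> n0; apply: le_trans (H2 n n0); rewrite le_eqVlt; apply/orP; left; apply/eqP.
  by congr (`|_ - _|); rewrite /a /y; field.
have aA1 n := @aA 1%N n isT; have aA2 n := @aA 2%N n isT; have aA3 n := @aA 3%N n isT.
split; [split|].
- exists (fun n => R1 n - (1 + mom 1%N / Num.sqrt n%:R)).
    exact: (mean_littleo _ _ _ _ _ _ _ K10 aA2 aA3 (am 1%N) R1E).
  by move=> n n0; rewrite ErhoE /=; ring.
- exists (fun n => n%:R * (R2 n - R1 n ^+ 2) - v0).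
    exact: (var_littleo _ _ _ _ _ _ _ _ _ _ A1 K10 K20 aA1 aA2 aA3 (am 1%N) (am 2%N) R1E R2E).
  by move=> n n0; rewrite VrhoE /=; ring.
move=> [e1 e1o He1] [e2 e2o He2].
have mom1 : mean P' (M \o U) = mom 1%N by congr mean; apply/funext => w /=; rewrite expr1.
pose H := sum3 (fun alpha => coef alpha * h alpha).
pose Rr := sum3 (fun alpha => coef alpha * r alpha).
(* The Edgeworth errors are rewritten as [isqrt n] times sequences that tend to 0. *)
have g1E n : (0 < n)%N ->
    a 1%N n = mom 1%N + isqrt n * H + isqrt n * ((isqrt n)^-1 * e1 n).
  move=> n0; rewrite mulrA divff ?gt_eqF ?isqrt_gt0// mul1r.
  by rewrite -mom1 -(He1 n n0) ESE.
have g2E n : (0 < n)%N ->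
    a 2%N n = mom 2%N + isqrt n * Rr + isqrt n * ((isqrt n)^-1 * e2 n).
  move=> n0; rewrite mulrA divff ?gt_eqF ?isqrt_gt0// mul1r.
  by have := He2 n n0; rewrite ESE.
have g10 := littleo_cvg _ e1o; have g20 := littleo_cvg _ e2o.
split.
- exists (fun n => R1 n - (1 + mom 1%N / Num.sqrt n%:R + n%:R^-1 * (mom 2%N / 2 + H))).
    exact: (mean_littleo2 _ _ _ _ _ _ _ _ K10 aA3 (am 2%N) R1E _ _ g1E g10).
  by move=> n n0; rewrite ErhoE -/H /=; ring.
exists (fun n => n%:R * (R2 n - R1 n ^+ 2) - (mom 2%N - mom 1%N ^+ 2 +
     (Num.sqrt n%:R)^-1 * ((mom 3%N - mom 1%N * mom 2%N) + (Rr - 2 * mom 1%N * H)))).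
  exact: (var_littleo2 _ _ _ _ _ _ _ _ _ _ _ A1 K10 K20 aA1 aA2 aA3
    (am 1%N) (am 2%N) (am 3%N) R1E R2E _ _ _ _ g1E g2E g10 g20).
move=> n n0; rewrite VrhoE.
have -> : sum3 (fun alpha => coef alpha * (r alpha - 2 * mom 1%N * h alpha)) =
    Rr - 2 * mom 1%N * H.
  rewrite -sum3_linear; congr sum3; apply/funext => alpha; ring.
by rewrite /v0 /v1; ring.
Qed.
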